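(* Let $X_1,X_2$ be compact metrizable spaces, let $q_1,q_2\ge0$ and let $$U_{q_1q_2}:=\{([x_1,r_1],[x_2,r_2])\in\mathfrak C[X_1]\times\mathfrak C[X_2]:\ r_2>r_1q_1,\ r_1>r_2q_2\}.$$ Let $H:\mathfrak C[X_1]\times\mathfrak C[X_2]\to[0,+\infty]$ be continuous, radially $1$-homogeneous and radially convex, with effective domain $\mathrm D(H)=U_{q_1q_2}$ and $$\lim_{r_1\downarrow q_2}\ \inf_{(x_1,x_2)\in X_1\times X_2}H([x_1,r_1],[x_2,1])=\lim_{r_2\downarrow q_1}\ \inf_{(x_1,x_2)\in X_1\times X_2}H([x_1,1],[x_2,r_2])=+\infty.$$ Let $\mu_i\in\mathcal M_+(X_i)$ be such that $$\operatorname{supp}\mu_i=X_i,\ i=1,2,\qquad q_1<\frac{\mu_2(X_2)}{\mu_1(X_1)},\qquad q_2<\frac{\mu_1(X_1)}{\mu_2(X_2)}.$$ Then there exists $(\varphi_1,\varphi_2)\in\Phi_H$ such that $$\int_{X_1}\varphi_1\,d\mu_1+\int_{X_2}\varphi_2\,d\mu_2=\mathcal U_H(\mu_1,\mu_2).$$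
   Context: $\mathcal M_+(X)$ is the set of finite nonnegative Radon measures on $X$; $C_b(X)$ is the space of bounded continuous real functions on $X$. Cone: $\mathfrak C[X]=(X\times[0,+\infty))/\sim$, where $(x,r)\sim(y,s)$ iff ($x=y$ and $r=s\neq0$) or $r=s=0$; $[x,r]$ is the class of $(x,r)$ and $\mathfrak o=[x,0]$ the vertex. A neighbourhood base at $[x,r]$ with $r>0$ is given by the images of the neighbourhoods of $(x,r)$ in the product topology; at $\mathfrak o$ by the sets $\{[x,r]:0\le r<\varepsilon\}$, $\varepsilon>0$. Products of cones have the product topology. The effective domain of $H$ is $\mathrm D(H):=\{H<+\infty\}$. $H$ is radially $1$-homogeneous if $H([x_1,\lambda r_1],[x_2,\lambda r_2])=\lambda H([x_1,r_1],[x_2,r_2])$ for all $\lambda>0$, $x_i\in X_i$, $r_i\ge0$; radially convex if $(r_1,r_2)\mapsto H([x_1,r_1],[x_2,r_2])$ is convex on $[0,+\infty)^2$ for all $(x_1,x_2)\in X_1\times X_2$. $\Phi_H$ is the set of $(\varphi_1,\varphi_2)\in C_b(X_1)\times C_b(X_2)$ with $\varphi_1(x_1)r_1+\varphi_2(x_2)r_2\le H([x_1,r_1],[x_2,r_2])$ for all $x_i\in X_i$, $r_i\ge0$. $\mathcal U_H(\mu_1,\mu_2):=\inf\{\int H\,d\alpha:\alpha\in\mathfrak H^1(\mu_1,\mu_2)\}$, where $\mathfrak H^1(\mu_1,\mu_2)$ is the set of nonnegative finite Radon measures $\alpha$ on $\mathfrak C[X_1]\times\mathfrak C[X_2]$ with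 $\int(r_1+r_2)\,d\alpha<+\infty$ and $\mu_i(A)=\int_{\{r_i>0,\ x_i\in A\}}r_i\,d\alpha([x_1,r_1],[x_2,r_2])$ for every Borel $A\subset X_i$, $i=1,2$.
   Formalization: As stated, continuity of H at (𝔬,𝔬) contradicts D(H)=U and homogeneity; the formal version asks for continuity of H only away from (𝔬,𝔬), and D(H)=U only up to the point (𝔬,𝔬), where H may be 0 or +∞. *)

(* Defs.v *)
From HB Require Import structures.
From mathcomp Require Import all_boot all_order all_algebra.
From mathcomp Require Import all_classical all_reals all_analysis.

Set Implicit Arguments.
Unset Strict Implicit.
Unset Printing Implicit Defensive.

Import Order.TTheory GRing.Theory Num.Theory.
Import numFieldNormedType.Exports.

Local Open Scope classical_set_scope.
Local Open Scope ring_scope.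
Local Open Scope quotient_scope.

Definition metrizable (R : realType) (X : topologicalType) : Prop :=
  exists d : X -> X -> R,
    [/\ forall x y, d x y = 0 <-> x = y,
        forall x y, d x y = d y x,
        forall x y z, d x z <= d x y + d y z &
        forall x A, nbhs x A <-> exists2 e, 0 < e & [set y | d x y < e] `<=` A].

Section cone.
Context (R : realType) (X : ptopologicalType).

Definition cone_rel (u v : X * {nonneg R}) : bool :=
  [&& u.1 == v.1, u.2 == v.2 & u.2%:num != 0]
  || (u.2%:num == 0) && (v.2%:num == 0).

Lemma cone_rel_refl : reflexive cone_rel.
Proof. by move=> u; rewrite /cone_rel !eqxx; case: eqP. Qed.

Lemma cone_rel_sym : symmetric cone_rel.
Proof.
move=> u v; rewrite /cone_rel [u.1 == _]eq_sym [u.2 == v.2]eq_sym.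
by case: (v.2 =P u.2) => [->|_]; rewrite ?andbF //= andbC.
Qed.

Lemma cone_rel_trans : transitive cone_rel.
Proof.
move=> [v1 v2] [u1 u2] [w1 w2]; rewrite /cone_rel/=.
case/orP => [/and3P[/eqP-> /eqP-> v0]|/andP[u0 v0]].
  by rewrite (negPf v0) /= andbT orbF => /andP[-> ->].
by rewrite u0 v0/= !andbF.
Qed.

Canonical cone_equiv := EquivRel cone_rel cone_rel_refl cone_rel_sym cone_rel_trans.

Definition cone : Type := {eq_quot cone_equiv}.

HB.instance Definition _ := Choice.on cone.

Definition cone_class (x : X) (r : {nonneg R}) : cone :=
  \pi_({eq_quot cone_equiv}) (x, r).

Definition apex : cone := cone_class point 0%:nng.

Definition cone_radius (y : cone) : R := (repr (y : {eq_quot cone_equiv})).2%:num.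

(* Canonical only where the radius is positive; at the apex an arbitrary point. *)
Definition cone_base (y : cone) : X := (repr (y : {eq_quot cone_equiv})).1.

Lemma cone_classP x r (v := repr (cone_class x r : {eq_quot cone_equiv})) :
  cone_rel (x, r) v.
Proof.
by apply/(eqmodP cone_equiv); rewrite /v reprK.
Qed.

Lemma cone_radiusE x r : cone_radius (cone_class x r) = r%:num.
Proof.
rewrite /cone_radius; have := cone_classP x r; rewrite /cone_rel /=.
by case/orP => [/and3P[_ /eqP<- _]|/andP[/eqP-> /eqP->]].
Qed.

Lemma cone_baseE x r : 0 < r%:num -> cone_base (cone_class x r) = x.
Proof.
move=> r0; rewrite /cone_base; have := cone_classP x r; rewrite /cone_rel /=.
by rewrite (gt_eqF r0) /= orbF => /andP[/eqP<-].
Qed.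

Lemma cone_apexE x : cone_class x 0%:nng = apex.
Proof. by apply/(eqmodP cone_equiv); rewrite /cone_equiv /= /cone_rel /= !eqxx orbT. Qed.

Lemma cone_radius_ge0 y : 0 <= cone_radius y.
Proof. by rewrite /cone_radius. Qed.

Lemma coneP (y : cone) : exists x r, y = cone_class x r.
Proof.
exists (repr (y : {eq_quot cone_equiv})).1, (repr (y : {eq_quot cone_equiv})).2.
by rewrite /cone_class -surjective_pairing reprK.
Qed.

(* Not the quotient topology in general: the sets of small radius are imposed
   as a neighbourhood base at the apex. *)
Definition cone_nbhs (y : cone) : set_system cone :=
  if cone_radius y == 0 then
    [set A | exists2 e, 0 < e & [set z | cone_radius z < e] `<=` A]
  else
    [set A | exists2 N, nbhs ((cone_base y, cone_radius y) : X * R) N &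
       forall x (s : {nonneg R}), N (x, s%:num) -> A (cone_class x s)].

HB.instance Definition _ := hasNbhs.Build cone cone_nbhs.

Lemma cone_nbhs_singleton (y : cone) (A : set cone) : nbhs y A -> A y.
Proof.
rewrite {1}/nbhs/= /cone_nbhs; case: ifPn => [/eqP y0 [e e0]|y0 [N /nbhs_singleton Ny]].
  by apply => /=; rewrite y0.
have [x [r E]] := coneP y; move: y0 Ny; rewrite E cone_radiusE => r0 Ny.
by apply; rewrite cone_baseE in Ny => //; rewrite lt_def r0 /=.
Qed.

Lemma cone_nbhs_filter (y : cone) : ProperFilter (nbhs y).
Proof.
apply: Build_ProperFilter_ex; first by move=> A /cone_nbhs_singleton; exists y.
rewrite /nbhs/= /cone_nbhs; case: ifPn => y0; split.
- by exists 1.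
- move=> A B [e e0 eA] [f f0 fB]; exists (Num.min e f); first by rewrite lt_min e0.
  by move=> z /=; rewrite lt_min => /andP[/eA ? /fB].
- by move=> A B AB [e e0 eA]; exists e => // z /eA /AB.
- by exists setT => //; exact: filterT.
- move=> A B [M yM MA] [N yN NB]; exists (M `&` N); first exact: filterI.
  by move=> x s [/MA ? /NB].
- by move=> A B AB [N yN NA]; exists N => // x s /NA /AB.
Qed.

Lemma cone_nbhs_nbhs (y : cone) (A : set cone) : nbhs y A -> nbhs y (nbhs^~ A).
Proof.
rewrite {1 2}/nbhs/= /cone_nbhs; case: ifPn => [y0 [e e0 eA]|y0 [N yN NA]].
  exists e => // z /= ze; rewrite /nbhs/= /cone_nbhs; case: ifPn => z0.
    by exists e.
  exists [set p : X * R | p.2 < e].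
    exists (setT, [set r | r < e]) => /=.
      by split; [exact: filterT | exact: lt_nbhsl].
    by move=> p [].
  by move=> x s /= se; apply: eA; rewrite /= cone_radiusE.
have [P [oP Py PN]] : exists P, [/\ open P, P (cone_base y, cone_radius y) & P `<=` N].
  by move: yN; rewrite nbhsE => -[P [? ?] ?]; exists P.
exists (P `&` [set p : X * R | 0 < p.2]).
  apply: filterI; first exact: open_nbhs_nbhs.
  exists (setT, [set r | 0 < r]) => /=; last by move=> p [].
  split; first exact: filterT.
  by apply: lt_nbhsr; rewrite lt_def y0 cone_radius_ge0.
move=> x s [/= Pxs s0]; rewrite /nbhs/= /cone_nbhs cone_radiusE gt_eqF// cone_baseE//.
exists P; first exact: open_nbhs_nbhs.
by move=> x' s' /PN /NA.
Qed.

HB.instance Definition _ := Nbhs_isNbhsTopological.Build cone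
  cone_nbhs_filter cone_nbhs_singleton cone_nbhs_nbhs.

HB.instance Definition _ := isPointed.Build cone apex.

End cone.

Arguments cone_class {R X}.
Arguments apex {R X}.

(* The library lacks this join of its topological and pointed instances. *)
HB.instance Definition _ (X Y : ptopologicalType) := Pointed.on (X * Y)%type.

Notation borel T := (g_sigma_algebraType (@open T)).

Section measures.
Context (R : realType) (T : ptopologicalType).

(* Inner regularity; only used for finite measures on Hausdorff spaces. *)
Definition radon (mu : set (borel T) -> \bar R) : Prop :=
  forall A : set (borel T), measurable A -> forall e : R, 0 < e ->
    exists K : set T, [/\ compact K, K `<=` A & (mu (A `\` K) < e%:E)%E].

Definition msupport (mu : set (borel T) -> \bar R) : set T :=
  [set x | forall O : set T, open O -> O x -> (0 < mu O)%E].

Definition Cb : set (T -> R) :=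
  [set phi | continuous phi /\ exists M : R, forall x, `|phi x| <= M].

End measures.
Arguments Cb : clear implicits.
Arguments radon {R} T mu.
Arguments msupport {R} T mu.

Section transport.
Context (R : realType) (X1 X2 : ptopologicalType).
Local Notation C := (cone R X1 * cone R X2)%type.
Implicit Type H : C -> \bar R.

Definition rad1 (y : C) : R := cone_radius y.1.
Definition rad2 (y : C) : R := cone_radius y.2.
Definition base1 (y : C) : X1 := cone_base y.1.
Definition base2 (y : C) : X2 := cone_base y.2.

Definition radially_homogeneous H : Prop :=
  forall (l : {posnum R}) x1 x2 (r1 r2 : {nonneg R}),
    H (cone_class x1 (l%:num * r1%:num)%:nng, cone_class x2 (l%:num * r2%:num)%:nng)
    = (l%:num%:E * H (cone_class x1 r1, cone_class x2 r2))%E.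

Definition radially_convex H : Prop :=
  forall x1 x2 (r1 r2 s1 s2 a b : {nonneg R}), a%:num + b%:num = 1 ->
    (H (cone_class x1 (a%:num * r1%:num + b%:num * s1%:num)%:nng,
        cone_class x2 (a%:num * r2%:num + b%:num * s2%:num)%:nng)%R
     <= a%:num%:E * H (cone_class x1 r1, cone_class x2 r2)
        + b%:num%:E * H (cone_class x1 s1, cone_class x2 s2))%E.

Definition effective_domain H : set C := [set y | (H y < +oo)%E].

(* U_ misses (apex, apex), and a radially 1-homogeneous H finite exactly on a
   nonempty U_ and at most at (apex, apex) is never continuous there: it tends
   to 0 along rays inside U_ and is +oo along (apex, [x, r]), r -> 0.
   Continuity and the domain are thus to be prescribed off (apex, apex). *)
Definition U_ (q1 q2 : R) : set C :=
  [set y | rad2 y > rad1 y * q1 /\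
           rad1 y > rad2 y * q2].

Definition Phi_ H : set ((X1 -> R) * (X2 -> R)) :=
  [set phi | [/\ Cb R X1 phi.1, Cb R X2 phi.2 &
     forall x1 x2 (r1 r2 : {nonneg R}),
       ((phi.1 x1 * r1%:num + phi.2 x2 * r2%:num)%:E
        <= H (cone_class x1 r1, cone_class x2 r2))%E]].

Definition homogeneous_couplings
    (mu1 : set (borel X1) -> \bar R) (mu2 : set (borel X2) -> \bar R) :
    set {finite_measure set (borel C) -> \bar R} :=
  [set alpha : {finite_measure set (borel C) -> \bar R} | [/\ radon C alpha,
     (\int[alpha]_y (rad1 y + rad2 y)%:E < +oo)%E,
     forall A : set (borel X1), measurable A ->
       mu1 A = (\int[alpha]_(y in [set y | (0 < rad1 y)%R /\ A (base1 y)])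
                 (rad1 y)%:E)%E &
     forall A : set (borel X2), measurable A ->
       mu2 A = (\int[alpha]_(y in [set y | (0 < rad2 y)%R /\ A (base2 y)])
                 (rad2 y)%:E)%E]].

Definition unbalanced_cost H
    (mu1 : set (borel X1) -> \bar R) (mu2 : set (borel X2) -> \bar R) : \bar R :=
  ereal_inf [set (\int[alpha]_y H y)%E | alpha in homogeneous_couplings mu1 mu2].

End transport.

(* Main.v *)
Require Import Defs.
From HB Require Import structures.
From mathcomp Require Import all_boot all_order all_algebra.
From mathcomp Require Import finmap.
From mathcomp Require Import all_classical all_reals all_analysis.
From mathcomp Require Import measurable_realfun.
From mathcomp Require Import ring lra.

Set Implicit Arguments.
Unset Strict Implicit.
Unset Printing Implicit Defensive.

Import Order.TTheory GRing.Theory Num.Theory.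
Import numFieldNormedType.Exports.

Local Open Scope classical_set_scope.
Local Open Scope ring_scope.


(** By homogeneity, [H] is determined by its slices
    [h x1 x2 t = H ([x1, 1 - t], [x2, t])] with [0 <= t <= 1], and a pair of
    continuous potentials belongs to [Phi_ H] iff
    [phi1 x1 * (1 - t) + phi2 x2 * t <= h x1 x2 t] throughout.  The slices are
    continuous with values in [0, +oo]; they are finite exactly when
    [q1 * (1 - t) < t] and [q2 * t < 1 - t], and by compactness they tend to
    [+oo] uniformly as [t] tends to [0] or [1] ([compact_blowup]).  Write [M1],
    [M2] for the total masses.  The mass condition says that
    [t0 = M2 / (M1 + M2)] is interior to the range where [h] is finite, so that
    [h] is at most a constant [C] at [t0 - delta] and [t0 + delta].

    These two values of [t] bound potentials from above: feasible potentials with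
    a nonnegative dual value are at most [S = (C + 2) * (1 + 1 / delta)].  Hence
    only the truncation [k = min h L] with [L > S] matters.  It is real valued and
    uniformly continuous, and it is at least [S] near [t = 0] and [t = 1].

    One inequality between the two problems is integration of the constraint
    against a coupling ([weak_duality]).  The other one comes from a
    discretization which treats both problems at once.  Partitions of unity
    [chi_i], [psi_j] and a grid [t_l] lead to a finite linear program; minimizing
    its cost plus a quadratic penalty over the nonnegative orthant gives weights
    [w_ijl] and multipliers [u_i], [v_j] with complementary slackness
    ([penalized_duality], [discrete_duality]).
    - The functions [sum u_i chi_i] and [sum v_j psi_j] are dual feasible up to a
      small constant, and integrate to the discrete dual value.
    - The weights give continuous densities [a = sum w chi psi (1 - t)] and
      [b = sum w chi psi t] on [X1 * X2].  After a small correction that makes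
      [a (x1, -)] and [b (-, x2)] integrate to [1], the image of the product
      measure under [x |-> ([x1, a x], [x2, b x])] is a homogeneous coupling
      ([continuous_coupling]), whose cost is controlled because [H], convex and
      homogeneous, is sublinear in the radii ([primal_bound]).
    So the discrete value bounds both problems up to an error that tends to [0].

    For attainment, near-optimal potentials are replaced by their transforms
    ([cost_transform], [potentials_improve]), which are larger, bounded, and
    equicontinuous with a modulus that depends only on [k].  Along an ultrafilter
    on the indices they converge uniformly ([ultra_uniform_limit]), and the limit
    is feasible with dual value at least the primal one. *)

(** * A penalized finite linear program *)

Lemma continuous_sumr (R : realType) (T : topologicalType) (I : Type)
    (r : seq I) (P : pred I) (g : I -> T -> R) :
  (forall i, P i -> continuous (g i)) ->
  continuous (fun x => \sum_(i <- r | P i) g i x).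
Proof.
move=> cg x; apply: (@cvg_big R I +%R) => [|i /cg]; last exact.
by move=> z; apply: cvgD; [exact: cvg_fst|exact: cvg_snd].
Qed.

(** A minimum at the end point [s = 0] of a quadratic without constant term
    forces a nonnegative slope. *)
Lemma slope_ge0 (R : realType) (G Q : R) :
  (forall s, 0 < s <= 1 -> 0 <= s * G + s ^+ 2 * Q) -> 0 <= G.
Proof.
move=> H; rewrite leNgt; apply/negP => G0.
have Q0 : 0 < Q.
  have := H 1; rewrite ltr01 lexx => /(_ isT); rewrite !mul1r expr1n mul1r => ?.
  lra.
pose s := Num.min 1 (- G / (Q * 2)).
have s0 : 0 < s.
  by rewrite /s lt_min ltr01 /= divr_gt0 ?oppr_gt0 ?mulr_gt0.
have s1 : s <= 1 by rewrite /s ge_min lexx.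
have sQ : s * (Q * 2) <= - G.
  have : s <= - G / (Q * 2) by rewrite /s ge_min lexx orbT.
  by rewrite ler_pdivlMr// mulr_gt0.
have := H s; rewrite s0 s1 => /(_ isT).
have -> : s * G + s ^+ 2 * Q = s * (G + s * Q) by ring.
rewrite pmulr_rge0//; lra.
Qed.

Lemma continuous_penalized (R : realType) (T : topologicalType) (P K : finType)
    (A : P -> K -> R) (c : K -> R) (m : P -> R) (tau : R) (w : T -> K -> R) :
  (forall k, continuous (w ^~ k)) ->
  continuous (fun x => \sum_k c k * w x k
    + \sum_p m p * (1 - \sum_k A p k * w x k) ^+ 2 / (tau * 2)).
Proof.
move=> cw.
have cres p : continuous (fun x => 1 - \sum_k A p k * w x k).
  move=> x; apply: cvgB; first exact: cvg_cst.
  apply: continuous_sumr => k _ y.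
  by apply: cvgM; [exact: cvg_cst|exact: cw].
move=> x; apply: cvgD.
  apply: continuous_sumr => k _ y.
  by apply: cvgM; [exact: cvg_cst|exact: cw].
apply: continuous_sumr => p _ y.
apply: cvgM; last exact: cvg_cst.
apply: cvgM; first exact: cvg_cst.
by under eq_cvg do rewrite expr2; rewrite expr2; apply: cvgM; exact: cres.
Qed.

(** Minimizing [sum c w + (1 / (2 tau)) sum m (1 - A w)^2] over [w >= 0]
    replaces linear programming duality.  The multiplier of row [p] is the scaled
    residual [z p = (1 - A w) p / tau]: moving [w] along a coordinate gives the
    dual constraint, and shrinking [w] gives complementary slackness.  Positivity
    of all costs makes the objective coercive. *)
Lemma penalized_duality (R : realType) (P K : finType) (A : P -> K -> R)
    (c : K -> R) (m : P -> R) (tau : R) :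
  0 < tau -> (forall k, 0 < c k) -> (forall p, 0 <= m p) ->
  exists w z, [/\ forall k, 0 <= w k,
    forall p, \sum_k A p k * w k = 1 - tau * z p,
    forall k, \sum_p m p * A p k * z p <= c k &
    forall k, w k * (c k - \sum_p m p * A p k * z p) = 0].
Proof.
move=> tau0 c0 m0.
pose res w p : R := 1 - \sum_k A p k * w k.
pose F w : R := \sum_k c k * w k + \sum_p m p * (res w p) ^+ 2 / (tau * 2).
have pen0 w : 0 <= \sum_p m p * (res w p) ^+ 2 / (tau * 2).
  apply: sumr_ge0 => p _; apply: divr_ge0; last by rewrite mulr_ge0 ?ltW.
  by rewrite mulr_ge0 ?sqr_ge0 ?m0.
(* Outside this box one cost term alone exceeds the value [F0] at [0]. *)
pose F0 := F (fun=> 0).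
pose Box := [set w : prod_topology (fun _ : K => R^o) |
             forall k, [set` `[0, F0 / c k]] (w k)].
have F00 : 0 <= F0.
  rewrite /F0 /F big1 ?add0r; first exact: (pen0 (fun=> 0)).
  by move=> k _; rewrite mulr0.
have cB : compact Box.
  exact: (@tychonoff K (fun=> R^o) (fun k => [set` `[0, F0 / c k]])
    (fun k => @segment_compact R _ _)).
have B0 : Box (fun=> 0).
  by move=> k /=; rewrite in_itv /= lexx divr_ge0// ltW.
have cproj (k : K) : continuous (fun w : prod_topology (fun _ : K => R^o) => w k).
  exact: (@proj_continuous K (fun=> R^o)).
have cF := @continuous_penalized R (prod_topology (fun _ : K => R^o)) P K A c m tau
  (fun w => w) cproj.
have [w wB wmin] := @compact_EVT_min _ R (F : prod_topology (fun _ : K => R^o) -> R) Box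
   (ex_intro _ _ B0) cB (continuous_subspaceT cF).
have w0 k : 0 <= w k.
  by have := set_mem wB k; rewrite /= in_itv /= => /andP[].
have wF0 : F w <= F0 by apply: wmin; exact/mem_set.
have Fmin v : (forall k, 0 <= v k) -> F w <= F v.
  move=> v0; have [vB|] := pselect (Box v); first by apply: wmin; exact/mem_set.
  move/existsNP => [k]; rewrite /= in_itv /= v0 /= => /negP.
  rewrite -ltNge ltr_pdivrMr// mulrC => vk.
  apply: (le_trans wF0); apply: (le_trans (ltW vk)).
  apply: (@le_trans _ _ (\sum_k c k * v k)); last by rewrite lerDl.
  rewrite (bigD1 k)//= lerDl sumr_ge0// => j _.
  by rewrite mulr_ge0// ltW.
pose z p := res w p / tau.
pose g k := c k - \sum_p m p * A p k * z p.
have dir d : (forall s, 0 < s <= 1 -> forall k, 0 <= w k + s * d k) ->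
    0 <= \sum_k g k * d k.
  move=> dw; apply: (@slope_ge0 _ _
    (\sum_p m p * (\sum_k A p k * d k) ^+ 2 / (tau * 2))) => s s01.
  have := Fmin _ (dw s s01); rewrite -subr_ge0; congr (0 <= _).
  rewrite /F.
  have -> : \sum_k c k * (w k + s * d k) = \sum_k c k * w k + s * \sum_k c k * d k.
    rewrite mulr_sumr -big_split/=; apply: eq_bigr => k _; ring.
  have -> : \sum_k g k * d k = \sum_k c k * d k -
      \sum_p m p * z p * \sum_k A p k * d k.
    rewrite /g; under eq_bigr do rewrite mulrBl.
    rewrite sumrB; congr (_ - _).
    under eq_bigr do rewrite mulr_suml.
    rewrite exchange_big/=; apply: eq_bigr => p _.
    rewrite mulr_sumr; apply: eq_bigr => k _; ring.
  have -> : \sum_p m p * res (fun k => w k + s * d k) p ^+ 2 / (tau * 2) =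
     \sum_p m p * res w p ^+ 2 / (tau * 2)
     - s * (\sum_p m p * z p * \sum_k A p k * d k)
     + s ^+ 2 * \sum_p m p * (\sum_k A p k * d k) ^+ 2 / (tau * 2).
    rewrite !mulr_sumr -sumrB -big_split/=; apply: eq_bigr => p _.
    have -> : res (fun k => w k + s * d k) p = res w p - s * \sum_k A p k * d k.
      rewrite /res mulr_sumr -addrA -opprD -big_split/=.
      by congr (1 - _); apply: eq_bigr => k _; ring.
    rewrite /z; field; exact: lt0r_neq0.
  ring.
have g0 k : 0 <= g k.
  have := dir (fun j => (j == k)%:R).
  rewrite (bigD1 k)//= eqxx mulr1 big1 ?addr0; last first.
    by move=> j /negPf ->; rewrite mulr0.
  apply=> s /andP[s0 _] j.
  by rewrite addr_ge0// mulr_ge0// ltW.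
have gw0 : \sum_k g k * w k = 0.
  apply/eqP; rewrite eq_le; apply/andP; split; last first.
    by apply: sumr_ge0 => k _; rewrite mulr_ge0.
  have := dir (fun j => - w j).
  under eq_bigr do rewrite mulrN.
  rewrite sumrN oppr_ge0; apply => s /andP[_ s1] k.
  have -> : w k + s * - w k = (1 - s) * w k by ring.
  by rewrite mulr_ge0// subr_ge0.
exists w, z; split=> //.
- move=> p; rewrite /z mulrC divfK ?lt0r_neq0// /res; ring.
- by move=> k; rewrite -subr_ge0; exact: g0.
- move=> k; rewrite mulrC.
  have := @psumr_eq0P R K xpredT (fun k => g k * w k).
  by move=> /(_ (fun k _ => mulr_ge0 (g0 k) (w0 k)) gw0 k isT).
Qed.

Lemma sum_delta (R : realType) (I : finType) (a : I) (f : I -> R) :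
  \sum_i (a == i)%:R * f i = f a.
Proof.
rewrite (bigD1 a)//= eqxx mul1r big1 ?addr0// => i ia.
by rewrite eq_sym (negPf ia) mul0r.
Qed.

(** The minimum would do, but the inverse of [1 + sum 1 / m] also covers an
    empty index type. *)
Lemma positive_lower_bound (R : realType) (I : finType) (m : I -> R) :
  (forall i, 0 < m i) -> exists2 mm, 0 < mm & forall i, mm <= m i.
Proof.
move=> m0; have s0 : 0 <= \sum_i (m i)^-1.
  by apply: sumr_ge0 => i _; rewrite invr_ge0 ltW.
exists (1 + \sum_i (m i)^-1)^-1; first by rewrite invr_gt0; lra.
move=> i; rewrite -[leRHS]invrK lef_pV2 ?posrE ?invr_gt0//; last by lra.
rewrite (bigD1 i)//=.
have : 0 <= \sum_(j | j != i) (m j)^-1.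
  by apply: sumr_ge0 => j _; rewrite invr_ge0 ltW.
lra.
Qed.

(** The left-hand side is affine in [t], so that it does not decrease when [t]
    is moved to one of the two neighbouring grid points. *)
Lemma grid_interpolation (R : realType) (N : nat) (u v t : R) :
  (0 < N)%N -> 0 <= t <= 1 -> exists l : 'I_N.+1,
    `|t - l%:R / N%:R| <= N%:R^-1 /\
    u * (1 - t) + v * t <= u * (1 - l%:R / N%:R) + v * (l%:R / N%:R).
Proof.
move=> N0 /andP[t0 t1]; have NR : 0 < N%:R :> R by rewrite ltr0n.
have tN0 : 0 <= t * N%:R by rewrite mulr_ge0// ltW.
have := truncn_itv tN0; set p := Num.truncn _ => /andP[pt tp].
have pN : (p <= N)%N.
  by rewrite -(ler_nat R) (le_trans pt)// ler_piMl// ltW.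
have lp : p%:R / N%:R <= t by rewrite ler_pdivrMr.
have ltp : t < p%:R / N%:R + N%:R^-1.
  by rewrite -[X in _ < _ + X]mul1r -mulrDl ltr_pdivlMr// natr1.
have Ninv : 0 < (N%:R : R)^-1 by rewrite invr_gt0.
have [vu|uv] := leP v u.
  exists (inord p); rewrite inordK; last by rewrite ltnS.
  split; first by rewrite ler_norml; apply/andP; split; lra.
  rewrite -subr_ge0.
  set x := p%:R / N%:R in lp ltp *.
  have -> : u * (1 - x) + v * x - (u * (1 - t) + v * t) = (u - v) * (t - x) by ring.
  by rewrite mulr_ge0// subr_ge0.
have [pN'|pN'] := ltnP p N.
  exists (inord p.+1); rewrite inordK; last by rewrite ltnS.
  rewrite -natr1 mulrDl mul1r.
  set x := p%:R / N%:R in lp ltp *.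
  split; first by rewrite ler_norml; apply/andP; split; lra.
  rewrite -subr_ge0.
  have -> : u * (1 - (x + N%:R^-1)) + v * (x + N%:R^-1) - (u * (1 - t) + v * t)
      = (v - u) * (x + N%:R^-1 - t) by ring.
  by rewrite mulr_ge0// subr_ge0 ltW.
have pE : p = N by apply/eqP; rewrite eqn_leq pN.
exists ord_max => /=; rewrite divff ?gt_eqF//.
move: lp; rewrite pE divff ?gt_eqF// => tE.
have -> : t = 1 by lra.
by rewrite subrr normr0; split; [exact: ltW|].
Qed.

(** The upper bound on the multipliers uses the feasible directions
    [t0 - delta] and [t0 + delta] together with the sign of the dual value; it does
    not depend on the penalization, which is then chosen small enough for the
    residuals to be at most [eta].  The cost [k + eps] in place of [k] is positive,
    as [penalized_duality] requires. *)
Lemma discrete_duality (R : realType) (I J : finType) (m : I -> R) (n : J -> R)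
    (M1 M2 : R) (N : nat) (k : I -> J -> R -> R) (eps C t0 delta eta : R) :
  (forall i, 0 < m i) -> (forall j, 0 < n j) ->
  \sum_i m i = M1 -> \sum_j n j = M2 -> 0 < M1 -> 0 < M2 ->
  (0 < N)%N -> 0 < eps -> eps <= 1 ->
  (forall i j t, 0 <= t <= 1 -> 0 <= k i j t) ->
  (forall i j t s, 0 <= t <= 1 -> 0 <= s <= 1 -> `|t - s| <= N%:R^-1 ->
    `|k i j t - k i j s| <= eps) ->
  t0 * (M1 + M2) = M2 -> 0 < delta -> 0 <= t0 - delta -> t0 + delta <= 1 ->
  (forall i j, k i j (t0 - delta) <= C) ->
  (forall i j, k i j (t0 + delta) <= C) -> 0 < eta ->
  exists (w : I * J * 'I_N.+1 -> R) (u : I -> R) (v : J -> R),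
    [/\ forall p, 0 <= w p,
      forall i j t, 0 <= t <= 1 -> u i * (1 - t) + v j * t <= k i j t + 2 * eps,
      (forall i, u i <= (C + 2) * (1 + delta^-1)) /\
      (forall j, v j <= (C + 2) * (1 + delta^-1)),
      (forall i : I, `|\sum_(p : I * J * 'I_N.+1) (p.1.1 == i)%:R *
          (n p.1.2 * (1 - p.2%:R / N%:R)) * w p - 1| <= eta) /\
      (forall j : J, `|\sum_(p : I * J * 'I_N.+1) (p.1.2 == j)%:R *
          (m p.1.1 * (p.2%:R / N%:R)) * w p - 1| <= eta) &
      (forall p, 0 < w p ->
        k p.1.1 p.1.2 (p.2%:R / N%:R) <= (C + 2) * (1 + delta^-1)) /\
      \sum_(p : I * J * 'I_N.+1)
          m p.1.1 * n p.1.2 * (k p.1.1 p.1.2 (p.2%:R / N%:R) + eps) * w p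
        <= \sum_i m i * u i + \sum_j n j * v j].
Proof.
move=> m0 n0 mM nM M10 M20 N0 eps0 eps1 k0 kosc t0E delta0 delta_lo delta_hi.
move=> k_lo k_hi eta0; set S := (C + 2) * _.
pose grid (l : 'I_N.+1) : R := l%:R / N%:R.
have grid01 l : 0 <= grid l <= 1.
  by rewrite divr_ge0//= ler_pdivrMr ?ltr0n// mul1r ler_nat -ltnS.
have [i0 _] : exists i : I, true.
  apply/not_existsP => nI; move: M10; rewrite -mM big1 ?ltxx// => i.
  by have := nI i.
have [j0 _] : exists j : J, true.
  apply/not_existsP => nJ; move: M20; rewrite -nM big1 ?ltxx// => j.
  by have := nJ j.
have M12 : 0 < M1 + M2 by rewrite addr_gt0.
have C0 : 0 <= C.
  by apply: le_trans (k_lo i0 j0); apply: k0; rewrite delta_lo /=; lra.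
have di0 : 0 < delta^-1 by rewrite invr_gt0.
have S0 : 0 < S by rewrite /S mulr_gt0//; lra.
pose mn (p : I + J) := match p with inl i => m i | inr j => n j end.
have mn0 p : 0 < mn p by case: p => [i|j] /=.
(* [tau * B] is [eta ^ 2 * mm], where [B] bounds the dual value. *)
have [mm mm0 mmP] := positive_lower_bound mn0.
pose B := S * (M1 + M2).
have B0 : 0 < B by rewrite mulr_gt0.
pose tau := eta ^+ 2 * mm / B.
have tau0 : 0 < tau by rewrite divr_gt0// mulr_gt0// exprn_gt0.
pose A (p : I + J) (q : I * J * 'I_N.+1) := match p with
  | inl i => (q.1.1 == i)%:R * (n q.1.2 * (1 - grid q.2))
  | inr j => (q.1.2 == j)%:R * (m q.1.1 * grid q.2) end.
pose c (q : I * J * 'I_N.+1) := m q.1.1 * n q.1.2 * (k q.1.1 q.1.2 (grid q.2) + eps).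
have c0 q : 0 < c q.
  by rewrite /c !mulr_gt0//; have := k0 q.1.1 q.1.2 _ (grid01 q.2); lra.
have [w [z [w0 wz zc wc]]] :=
  @penalized_duality R _ _ A c mn tau tau0 c0 (fun p => ltW (mn0 p)).
pose u i := z (inl i); pose v j := z (inr j).
have sumA q : \sum_p mn p * A p q * z p =
    m q.1.1 * n q.1.2 * (u q.1.1 * (1 - grid q.2) + v q.1.2 * grid q.2).
  rewrite big_sumType/=.
  rewrite (eq_bigr (fun i => (q.1.1 == i)%:R *
    (m i * (n q.1.2 * (1 - grid q.2)) * u i))); last by move=> i _; rewrite /u; ring.
  rewrite sum_delta.
  rewrite (eq_bigr (fun j => (q.1.2 == j)%:R *
    (n j * (m q.1.1 * grid q.2) * v j))); last by move=> j _; rewrite /v; ring.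
  rewrite sum_delta; ring.
have feas_grid i j l : u i * (1 - grid l) + v j * grid l <= k i j (grid l) + eps.
  have := zc (i, j, l); rewrite sumA /c /= ler_pM2l// mulr_gt0//.
have feas i j t : 0 <= t <= 1 -> u i * (1 - t) + v j * t <= k i j t + 2 * eps.
  move=> t01; have [l [tl le]] := grid_interpolation (u i) (v j) N0 t01.
  apply: (le_trans le); have := feas_grid i j l.
  have := kosc i j _ _ t01 (grid01 l) tl; rewrite ler_norml -/(grid l) => /andP[h _] h'.
  lra.
have total : \sum_q c q * w q =
    \sum_p mn p * z p - tau * \sum_p mn p * z p ^+ 2.
  transitivity (\sum_q w q * \sum_p mn p * A p q * z p).
    apply: eq_bigr => q _; have := wc q; rewrite mulrBr mulrC => /eqP.
    by rewrite subr_eq0 mulrC => /eqP; rewrite mulrC => ->.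
  under eq_bigr do rewrite mulr_sumr.
  rewrite exchange_big/= mulr_sumr -sumrB; apply: eq_bigr => p _.
  transitivity (mn p * z p * (1 - tau * z p)); last by ring.
  by rewrite -wz mulr_sumr; apply: eq_bigr => q _; ring.
have split_z : \sum_p mn p * z p = \sum_i m i * u i + \sum_j n j * v j.
  by rewrite big_sumType.
have sq0 : 0 <= \sum_p mn p * z p ^+ 2.
  by apply: sumr_ge0 => p _; rewrite mulr_ge0 ?sqr_ge0// ltW.
have cost0 : 0 <= \sum_q c q * w q.
  by apply: sumr_ge0 => q _; rewrite mulr_ge0// ltW.
have dual0 : 0 <= \sum_i m i * u i + \sum_j n j * v j.
  rewrite -split_z; have : 0 <= tau * \sum_p mn p * z p ^+ 2.
    by rewrite mulr_ge0// ltW.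
  by move: cost0; rewrite total; lra.
have [uS vS] : (forall i, u i <= S) /\ (forall j, v j <= S).
  have [i1 _ imax] := @arg_maxP _ _ _ i0 xpredT u isT.
  have [j1 _ jmax] := @arg_maxP _ _ _ j0 xpredT v isT.
  have lo := feas i1 j1 (t0 - delta); have hi := feas i1 j1 (t0 + delta).
  have {}lo : u i1 * (1 - (t0 - delta)) + v j1 * (t0 - delta) <= C + 2.
    by apply: le_trans (lo _) _; [lra|have := k_lo i1 j1; lra].
  have {}hi : u i1 * (1 - (t0 + delta)) + v j1 * (t0 + delta) <= C + 2.
    by apply: le_trans (hi _) _; [lra|have := k_hi i1 j1; lra].
  have mid : 0 <= u i1 * (1 - t0) + v j1 * t0.
    have sU : \sum_i m i * u i <= M1 * u i1.
      by rewrite -mM mulr_suml; apply: ler_sum => i _; rewrite ler_pM2l//; exact: imax.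
    have sV : \sum_j n j * v j <= M2 * v j1.
      by rewrite -nM mulr_suml; apply: ler_sum => j _; rewrite ler_pM2l//; exact: jmax.
    have : 0 <= (u i1 * (1 - t0) + v j1 * t0) * (M1 + M2).
      have -> : (u i1 * (1 - t0) + v j1 * t0) * (M1 + M2) =
        u i1 * (M1 + M2) + (v j1 - u i1) * (t0 * (M1 + M2)) by ring.
      rewrite t0E; lra.
    by rewrite pmulr_lge0.
  have d1 : (v j1 - u i1) <= (C + 2) * delta^-1.
    by rewrite ler_pdivlMr//; lra.
  have d2 : (u i1 - v j1) <= (C + 2) * delta^-1.
    by rewrite ler_pdivlMr//; lra.
  have SE : S = C + 2 + (C + 2) * delta^-1 by rewrite /S mulrDr mulr1.
  have Cd0 : 0 <= (C + 2) * delta^-1 by rewrite mulr_ge0//; lra.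
  have t0lo : 0 <= t0 by lra.
  have t0hi : t0 <= 1 by lra.
  split=> [i|j].
    apply: le_trans (imax i isT) _; rewrite SE.
    have : t0 * (u i1 - v j1) <= (C + 2) * delta^-1.
      apply: (@le_trans _ _ (t0 * ((C + 2) * delta^-1))).
        by rewrite ler_wpM2l.
      by rewrite ler_piMl.
    lra.
  apply: le_trans (jmax j isT) _; rewrite SE.
  have : (1 - t0) * (v j1 - u i1) <= (C + 2) * delta^-1.
    apply: (@le_trans _ _ ((1 - t0) * ((C + 2) * delta^-1))).
      by rewrite ler_wpM2l// subr_ge0.
    by rewrite ler_piMl//; lra.
  lra.
have dualB : \sum_p mn p * z p <= B.
  rewrite split_z /B mulrDr; apply: lerD.
    rewrite -mM mulr_sumr; apply: ler_sum => i _; rewrite mulrC ler_pM2r//.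
  rewrite -nM mulr_sumr; apply: ler_sum => j _; rewrite mulrC ler_pM2r//.
have resid p : `|tau * z p| <= eta.
  suff : `|tau * z p| ^+ 2 <= eta ^+ 2.
    by rewrite ler_pXn2r// ?nnegrE ?normr_ge0// ltW.
  rewrite real_normK ?num_real//.
  have h1 : tau * (mn p * z p ^+ 2) <= B.
    apply: le_trans (_ : tau * \sum_p mn p * z p ^+ 2 <= _).
      rewrite ler_pM2l// (bigD1 p)//= lerDl sumr_ge0// => q _.
      by rewrite mulr_ge0 ?sqr_ge0// ltW.
    by move: cost0 dualB; rewrite total; lra.
  have h2 : tau * B = eta ^+ 2 * mm by rewrite /tau divfK// gt_eqF.
  have h3 : (tau * z p) ^+ 2 * mn p <= eta ^+ 2 * mm.
    rewrite -h2.
    have -> : (tau * z p) ^+ 2 * mn p = tau * (tau * (mn p * z p ^+ 2)) by ring.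
    by rewrite ler_pM2l.
  rewrite -(ler_pM2r mm0); apply: le_trans h3.
  by rewrite ler_wpM2l ?sqr_ge0.
exists w, u, v; split=> //.
- split=> [i|j].
    have := wz (inl i); rewrite /A /= => ->.
    by have := resid (inl i); rewrite addrC addKr normrN.
  have := wz (inr j); rewrite /A /= => ->.
  by have := resid (inr j); rewrite addrC addKr normrN.
- split=> [q wq|].
    have := wc q => /eqP; rewrite mulf_eq0 gt_eqF//= sumA /c subr_eq0 => /eqP.
    have mn_neq0 : m q.1.1 * n q.1.2 != 0 by rewrite mulf_neq0// gt_eqF.
    move/(mulfI mn_neq0); rewrite -/(grid q.2).
    have /andP[g0 g1] := grid01 q.2.
    have h1 : u q.1.1 * (1 - grid q.2) <= S * (1 - grid q.2).
      by rewrite ler_wpM2r ?subr_ge0.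
    have h2 : v q.1.2 * grid q.2 <= S * grid q.2 by rewrite ler_wpM2r.
    lra.
  rewrite -split_z.
  have := total; have : 0 <= tau * \sum_p mn p * z p ^+ 2.
    by rewrite mulr_ge0// ltW.
  rewrite /c /grid; lra.
Qed.

(** * Compact metrizable spaces *)

Lemma continuous_pair (T U V : topologicalType) (f : T -> U) (g : T -> V) x :
  f @ x --> f x -> g @ x --> g x ->
  (fun y => (f y, g y)) @ x --> (f x, g x).
Proof. exact: cvg_pair. Qed.

Section metrizable.
Context (R : realType) (X : topologicalType) (d : X -> X -> R).
Hypotheses (d0 : forall x y, d x y = 0 <-> x = y)
  (dC : forall x y, d x y = d y x)
  (dD : forall x y z, d x z <= d x y + d y z)
  (dN : forall x A, nbhs x A <-> exists2 e, 0 < e & [set y | d x y < e] `<=` A).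

Lemma metric_nbhs x e : 0 < e -> \forall y \near x, d x y < e.
Proof. by move=> e0; apply/dN; exists e. Qed.

Lemma metric_continuous x : continuous (d x).
Proof.
move=> y; apply/cvgrPdist_lt => e e0; near=> z.
rewrite ltr_norml.
have dyz : d y z < e by near: z; exact: metric_nbhs.
have := dD x y z; have := dD x z y; rewrite (dC z y) => *.
apply/andP; split; lra.
Unshelve. all: by end_near. Qed.

Lemma metric_ball_open x e : open [set y | d x y < e].
Proof.
have -> : [set y | d x y < e] = d x @^-1` [set r | r < e] by [].
apply: open_comp; last exact: open_lt.
by move=> y _; exact: metric_continuous.
Qed.

Lemma metric_refl x : d x x = 0. Proof. exact/d0. Qed.

Lemma metric_hausdorff : hausdorff_space X.
Proof.
move=> x y cxy; apply/d0/eqP; rewrite eq_le; apply/andP; split; last first.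
  by have := dD x y x; rewrite metric_refl (dC y x) => ?; lra.
apply/ler_addgt0Pl => e e0.
have e20 : 0 < e / 2 by rewrite divr_gt0.
have [z [/= dxz dyz]] := cxy _ _ (metric_nbhs x e20) (metric_nbhs y e20).
have := dD x z y; rewrite (dC z y) => ?; lra.
Qed.

End metrizable.

Lemma metrizable_hausdorff (R : realType) (X : topologicalType) :
  metrizable R X -> hausdorff_space X.
Proof. by move=> [d [? ? ? ?]]; exact: (@metric_hausdorff R X d). Qed.

(** The bump around a point is supported in a ball on which [P] holds, with a
    radius that depends on the point; that each bump is positive at its centre makes its
    integral positive against a measure of full support. *)
Lemma partition_of_unity (R : realType) (X : ptopologicalType)
    (P : X -> X -> Prop) :
  compact [set: X] -> metrizable R X ->
  (forall x, \forall y \near x, P x y) ->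
  exists (I : finType) (c : I -> X) (chi : I -> X -> R),
    [/\ forall i, continuous (chi i), forall i x, 0 <= chi i x,
      forall x, \sum_i chi i x = 1,
      forall i x, chi i x != 0 -> P (c i) x &
      forall i, 0 < chi i (c i)].
Proof.
move=> cX [d [d0 dC dD dN]] Pnear.
have /choice[r /= rP] : forall x, exists e, 0 < e /\ forall y, d x y < e -> P x y.
  by move=> x; have /dN[e e0 eP] := Pnear x; exists e.
have r0 x : 0 < r x by have [] := rP x.
have rp x y : d x y < r x -> P x y by have [_] := rP x; apply.
move: cX; rewrite compact_cover => /(_ X setT (fun x => [set y | d x y < r x])).
case=> [x _|x _|D _ Dcov].
- exact: (metric_ball_open dC dD dN).
- by exists x => //=; rewrite (metric_refl d0).
pose bump (i : D) y := Num.max 0 (r (val i) - d (val i) y).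
have bump0 i y : 0 <= bump i y by rewrite le_max lexx.
have cbump i : continuous (bump i).
  move=> y; apply: (@continuous_max R X (cst 0)); first exact: cvg_cst.
  apply: cvgB; first exact: cvg_cst.
  exact: (metric_continuous dC dD dN).
pose s y := \sum_i bump i y.
have s0 y : 0 < s y.
  have [x xD dxy] := Dcov y I.
  rewrite /s (bigD1 (FSetSub xD))//=; apply: ltr_pwDl.
    by rewrite lt_max subr_gt0 dxy orbT.
  exact: sumr_ge0.
exists D, val, (fun i y => bump i y / s y); split=> [i|i y|y|i y|i].
- move=> y; apply: cvgM; first exact: cbump.
  apply: cvgV; first by rewrite gt_eqF.
  by apply: continuous_sumr => j _; exact: cbump.
- by rewrite divr_ge0// ltW.
- by rewrite -mulr_suml divff//; exact: lt0r_neq0 (s0 y).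
- move=> b0; apply: rp; rewrite ltNge; apply/negP => dr.
  by move: b0; rewrite /bump max_l ?subr_le0 ?mul0r ?eqxx.
- rewrite divr_gt0// /bump (metric_refl d0) subr0 lt_max.
  by rewrite r0 orbT.
Qed.

(** Compactness of the second factor makes a neighbourhood of [a] uniform. *)
Lemma tube (A B : topologicalType) (K : set B) (a : A) (P : A -> B -> Prop) :
  compact K ->
  (forall b, K b -> \forall z \near (b, a), P z.2 z.1) ->
  \forall a' \near a, forall b, K b -> P a' b.
Proof.
move=> /compact_near_coveringP cov h.
have : \forall a' \near a, K `<=` P a'.
  apply: (cov A (nbhs a) P) => b Kb.
  have [[U V] [/= nU nV] UV] := h b Kb.
  by exists (U, V) => // -[b' a'] [/= Ub Va]; exact: (UV (b', a')).
by apply: filterS => a' h' b; exact: h'.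
Qed.

Lemma tube_oscillation (R : realType) (A B : topologicalType) (K : set B) (a : A)
    (f : A -> B -> R) (e : R) :
  compact K -> continuous (fun z : B * A => f z.2 z.1) -> 0 < e ->
  \forall a' \near a, forall b, K b -> `|f a b - f a' b| <= e.
Proof.
move=> cK cf e0; apply: tube => // b Kb.
have e20 : 0 < e / 2 by rewrite divr_gt0.
have cfa : (fun z : B * A => f a z.1) @ (b, a) --> f a b.
  have c1 : (fun z : B * A => (z.1, a)) @ (b, a) --> (b, a).
    apply: (@continuous_pair _ B A fst (fun _ : B * A => a) (b, a)).
      exact: cvg_fst.
    exact: cvg_cst.
  exact: (cvg_comp _ _ c1 (cf (b, a))).
have /cvgrPdist_lt /(_ _ e20) n1 := cfa.
have /cvgrPdist_lt /(_ _ e20) n2 := cf (b, a).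
near=> z.
have h1 : `|f a b - f a z.1| < e / 2 by near: z.
have h2 : `|f a b - f z.2 z.1| < e / 2 by near: z.
have -> : f a z.1 - f z.2 z.1 = (f a b - f z.2 z.1) - (f a b - f a z.1) by ring.
by apply: (le_trans (ler_normB _ _)); lra.
Unshelve. all: by end_near. Qed.

Lemma compact_ereal_bounded (R : realType) (Y : topologicalType)
    (f : Y -> \bar R) :
  compact [set: Y] -> continuous f -> (forall y, (f y < +oo)%E) ->
  exists M : R, forall y, (f y <= M%:E)%E.
Proof.
move=> /compact_near_coveringP cov cf fy.
have : \forall M \near (+oo : set_system R), [set: Y] `<=` (fun y => (f y <= M%:E)%E).
  apply: (cov R +oo (fun M y => (f y <= M%:E)%E)) => y _.
  have [r fr] : exists r : R, (f y < r%:E)%E.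
    have := fy y; case: (f y) => [s _|//|_]; last by exists 0; exact: ltNyr.
    by exists (s + 1); rewrite lte_fin; lra.
  exists ([set y' | (f y' < r%:E)%E], [set M | r <= M]).
    split => /=; last by apply: nbhs_pinfty_ge; exact: num_real.
    apply: (cf y [set x | (x < r%:E)%E]); apply: open_nbhs_nbhs; split => //.
    exact: open_ereal_lt_ereal.
  move=> [y' M] /= [h1 h2]; apply: (le_trans (ltW h1)).
  by rewrite lee_fin.
move=> /filter_ex[M hM]; exists M => y; exact: hM.
Qed.

(** For an extended-real continuous function, being [+oo] on a compact slice
    is a strong condition: nearby slices are uniformly large. *)
Lemma compact_blowup (R : realType) (Y : topologicalType) (f : Y * R -> \bar R)
    (t0 L : R) :
  compact [set: Y] -> continuous f -> (forall y, f (y, t0) = +oo%E) ->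
  exists2 sigma, 0 < sigma & forall y t, `|t0 - t| <= sigma -> (L%:E <= f (y, t))%E.
Proof.
move=> cY cf finf.
have : \forall t \near t0, forall y, [set: Y] y -> (L%:E <= f (y, t))%E.
  apply: tube => // y _.
  have : \forall z \near (y, t0), (L%:E < f z)%E.
    apply: (cf (y, t0) [set x | (L%:E < x)%E]); apply: open_nbhs_nbhs; split => /=.
      exact: open_ereal_gt_ereal.
    by rewrite finf ltry.
  by apply: filterS => -[y' t] /= /ltW.
move=> /nbhs_ballP[r /= r0 rP]; exists (r / 2); first by rewrite divr_gt0.
move=> y t h; apply: rP => //=; rewrite /ball /=; lra.
Qed.

(** Obtained from [tube_oscillation] with the increment [s - t] as the first
    variable, which makes the estimate uniform in [y] as well as in [t]. *)
Lemma uniform_osc (R : realType) (Y : topologicalType) (f : Y * R -> R) (e : R) :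
  compact [set: Y] -> continuous f -> 0 < e ->
  exists2 N, (0 < N)%N & forall y t s, 0 <= t <= 1 -> 0 <= s <= 1 ->
    `|t - s| <= N%:R^-1 -> `|f (y, t) - f (y, s)| <= e.
Proof.
move=> cY cf e0; pose K : set (Y * R) := [set: Y] `*` `[0, 1]%classic.
have cK : compact K by apply: compact_setX => //; exact: segment_compact.
have : \forall r \near (0 : R), forall z, K z ->
    `|f (z.1, z.2 + 0) - f (z.1, z.2 + r)| <= e.
  apply: (@tube_oscillation R R (Y * R)%type K 0 (fun r z => f (z.1, z.2 + r))) => //.
  move=> z.
  have c1 : (fun z : (Y * R) * R => (z.1.1, z.1.2 + z.2)) @ z -->
      (z.1.1, z.1.2 + z.2).
    apply: (@continuous_pair _ Y R (fun z : (Y * R) * R => z.1.1)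
      (fun z => z.1.2 + z.2) z).
      by apply: (@continuous_comp _ _ _ fst fst); exact: cvg_fst.
    apply: cvgD; last exact: cvg_snd.
    by apply: (@continuous_comp _ _ _ fst snd); [exact: cvg_fst|exact: cvg_snd].
  exact: (cvg_comp _ _ c1 (cf _)).
move=> /nbhs_ballP[r /= r0 rP].
have [N Nr] : exists N, N.+1%:R^-1 < r.
  by have [N _ /(_ N (leqnn N))] := near_infty_natSinv_lt (PosNum r0); exists N.
exists N.+1 => // y t s t01 s01 ts.
have := rP (s - t) _ (y, t) _; rewrite /= addr0 subrKC; apply.
  by rewrite /ball /= sub0r normrN distrC; exact: le_lt_trans ts Nr.
by split => //=; rewrite in_itv.
Qed.

(** * Improving potentials and passing to the limit *)

Definition dual_feasible (R : realType) (X1 X2 : Type) (k : X1 -> X2 -> R -> R)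
    (phi1 : X1 -> R) (phi2 : X2 -> R) : Prop :=
  forall x1 x2 t, 0 <= t <= 1 -> phi1 x1 * (1 - t) + phi2 x2 * t <= k x1 x2 t.

(** The modulus of continuity of transformed potentials is expressed by this
    relation, which is the same for all potentials: this is what makes families
    of transforms equicontinuous. *)
Definition close_cost (R : realType) (X1 X2 : Type) (k : X1 -> X2 -> R -> R)
    (e : R) (x y : X1) : Prop :=
  forall x2 t, 0 <= t <= 1 -> `|k x x2 t - k y x2 t| <= e.

(** The transform at [x] is the largest [l <= S] compatible with [phi2].
    Where [t >= 1 - sigma] the constraint is automatic, both potentials being at
    most [S <= k]; elsewhere the coefficient [1 - t] of [l] is at least [sigma], so
    that a change of [k] by [e] moves the transform by at most [e / sigma]. *)
Lemma cost_transform (R : realType) (X1 X2 : Type) (k : X1 -> X2 -> R -> R)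
    (S sigma : R) (phi1 : X1 -> R) (phi2 : X2 -> R) :
  0 <= S -> 0 < sigma ->
  (forall x1 x2 t, 0 <= t <= 1 -> 0 <= k x1 x2 t) ->
  (forall x1 x2 t, 1 - sigma <= t <= 1 -> S <= k x1 x2 t) ->
  (forall x, phi1 x <= S) -> (forall x, phi2 x <= S) -> dual_feasible k phi1 phi2 ->
  exists psi1, [/\ dual_feasible k psi1 phi2, forall x, phi1 x <= psi1 x,
    forall x, - (S / sigma) <= psi1 x <= S &
    forall x y e, 0 <= e -> close_cost k e x y -> psi1 x - psi1 y <= e / sigma].
Proof.
move=> S0 sg0 k0 kS p1S p2S sub.
pose Lam x := [set l | l <= S /\
  forall x2 t, 0 <= t <= 1 -> l * (1 - t) + phi2 x2 * t <= k x x2 t].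
have ubL x : ubound (Lam x) S by move=> l [].
have philam x : Lam x (phi1 x) by split=> // x2 t; exact: sub.
have supL x : has_sup (Lam x).
  by split; [exists (phi1 x)|exists S].
have sg_le x : sup (Lam x) <= S by apply: ge_sup => //; exists (phi1 x).
have le_sg x l : Lam x l -> l <= sup (Lam x).
  by move=> Ll; apply: ub_le_sup => //; exists S.
have slack l x2 t : l <= S -> 1 - sigma <= t <= 1 -> 0 <= t ->
    l * (1 - t) + phi2 x2 * t <= S.
  move=> lS /andP[_ t1] t0; have := p2S x2 => p2.
  have : l * (1 - t) <= S * (1 - t) by rewrite ler_wpM2r// subr_ge0.
  have : phi2 x2 * t <= S * t by rewrite ler_wpM2r.
  lra.
exists (fun x => sup (Lam x)); split=> [x1 x2 t|x|x|x y e e0 xy].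
- move=> /andP[t0 t1].
  have [->|tn1] := eqVneq t 1.
    have := sub x1 x2 1; rewrite ler01 lexx => /(_ isT).
    by rewrite subrr !mulr0.
  have tpos : 0 < 1 - t by rewrite subr_gt0 lt_neqAle tn1.
  rewrite -lerBrDr -ler_pdivlMr//.
  apply: ge_sup; first by exists (phi1 x1).
  move=> l [_ lP]; rewrite ler_pdivlMr// lerBrDr; apply: lP.
  by rewrite t0.
- exact: le_sg.
- rewrite sg_le andbT; apply: le_sg; split.
    apply: (@le_trans _ _ 0) => //; rewrite oppr_le0 divr_ge0// ltW//.
  move=> x2 t /andP[t0 t1]; have [ts|ts] := leP (1 - sigma) t.
    apply: (@le_trans _ _ S); last by apply: kS; rewrite ts.
    apply: slack; rewrite ?ts//.
    apply: (@le_trans _ _ 0) => //; rewrite oppr_le0 divr_ge0// ltW//.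
  apply: (@le_trans _ _ 0); last by apply: k0; rewrite t0.
  have p2 := p2S x2.
  have h1 : phi2 x2 * t <= S * t by rewrite ler_wpM2r.
  have h2 : S * t <= S by rewrite ler_piMr.
  have h3 : S <= S / sigma * (1 - t).
    rewrite -mulrA ler_peMr// ler_pdivlMl// mulr1; lra.
  rewrite mulNr; lra.
- rewrite lerBlDl; apply: ge_sup; first by exists (phi1 x).
  move=> l [lS lP]; rewrite -lerBlDr; apply: le_sg.
  have es : 0 <= e / sigma by rewrite divr_ge0// ltW.
  split; first by lra.
  move=> x2 t t01; have /andP[t0 t1] := t01.
  have [ts|ts] := leP (1 - sigma) t.
    apply: (@le_trans _ _ S); last by apply: kS; rewrite ts.
    by apply: slack; rewrite ?ts//; lra.
  have := lP x2 t t01; have := xy x2 t t01; rewrite ler_norml => /andP[_ h1] h2.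
  have h3 : e <= e / sigma * (1 - t).
    rewrite -mulrA ler_peMr// ler_pdivlMl// mulr1; lra.
  rewrite mulrBl; lra.
Qed.

(** Two transforms, the second one with the roles of the factors exchanged
    ([t] becoming [1 - t]). *)
Lemma potentials_improve (R : realType) (X1 X2 : Type) (k : X1 -> X2 -> R -> R)
    (S sigma : R) (phi1 : X1 -> R) (phi2 : X2 -> R) :
  0 <= S -> 0 < sigma ->
  (forall x1 x2 t, 0 <= t <= 1 -> 0 <= k x1 x2 t) ->
  (forall x1 x2 t, 1 - sigma <= t <= 1 -> S <= k x1 x2 t) ->
  (forall x1 x2 t, 0 <= t <= sigma -> S <= k x1 x2 t) ->
  (forall x, phi1 x <= S) -> (forall x, phi2 x <= S) -> dual_feasible k phi1 phi2 ->
  exists psi1 psi2, [/\ dual_feasible k psi1 psi2,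
    forall x, phi1 x <= psi1 x, forall x, phi2 x <= psi2 x,
    (forall x, `|psi1 x| <= S + S / sigma) /\
    (forall x, `|psi2 x| <= S + S / sigma) &
    (forall x y e, 0 <= e -> close_cost k e x y ->
      `|psi1 x - psi1 y| <= e / sigma) /\
    (forall x y e, 0 <= e ->
      close_cost (fun x2 x1 t => k x1 x2 (1 - t)) e x y ->
      `|psi2 x - psi2 y| <= e / sigma)].
Proof.
move=> S0 sg0 k0 kS kS' p1S p2S sub.
have [psi1 [sub1 le1 b1 m1]] := cost_transform S0 sg0 k0 kS p1S p2S sub.
pose k' x2 x1 t := k x1 x2 (1 - t).
have k0' x2 x1 t : 0 <= t <= 1 -> 0 <= k' x2 x1 t.
  by move=> t01; apply: k0; lra.
have kS1 x2 x1 t : 1 - sigma <= t <= 1 -> S <= k' x2 x1 t.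
  by move=> t01; apply: kS'; lra.
have sub' : dual_feasible k' phi2 psi1.
  move=> x2 x1 t t01; have := sub1 x1 x2 (1 - t).
  by rewrite subKr /k' => h; rewrite addrC; apply: h; lra.
have b1S x : psi1 x <= S by have /andP[] := b1 x.
have [psi2 [sub2 le2 b2 m2]] := cost_transform S0 sg0 k0' kS1 p2S b1S sub'.
have bnd (r : R) : - (S / sigma) <= r <= S -> `|r| <= S + S / sigma.
  have : 0 <= S / sigma by rewrite divr_ge0// ltW.
  by move=> ? /andP[? ?]; rewrite ler_norml; apply/andP; split; lra.
have sym (X Y : Type) (q : X -> Y -> R -> R) e x y :
    close_cost q e x y -> close_cost q e y x.
  by move=> h z t t01; rewrite distrC; exact: h.
exists psi1, psi2; split=> //.
- move=> x1 x2 t t01; have := sub2 x2 x1 (1 - t).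
  by rewrite /k' subKr => h; rewrite addrC; apply: h; lra.
- by split=> x; exact: bnd.
- split=> x y e e0 xy.
    by rewrite ler_norml lerNl opprB !m1//; exact: sym.
  by rewrite ler_norml lerNl opprB !m2//; exact: sym.
Qed.

Lemma dual_feasible_limit (R : realType) (X1 X2 : Type) (k : X1 -> X2 -> R -> R)
    (g1 : X1 -> R) (g2 : X2 -> R) :
  (forall e, 0 < e -> exists f1 f2, [/\ dual_feasible k f1 f2,
    forall x, `|f1 x - g1 x| <= e & forall x, `|f2 x - g2 x| <= e]) ->
  dual_feasible k g1 g2.
Proof.
move=> lim x1 x2 t t01; apply/ler_addgt0Pr => e e0.
have [f1 [f2 [sub h1 h2]]] := lim e e0.
have := sub x1 x2 t t01; have := h1 x1; have := h2 x2.
rewrite !ler_norml => /andP[a1 a2] /andP[b1 b2] c.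
have /andP[t0 t1] := t01.
have : g1 x1 * (1 - t) <= (f1 x1 + e) * (1 - t).
  by rewrite ler_wpM2r ?subr_ge0//; lra.
have : g2 x2 * t <= (f2 x2 + e) * t by rewrite ler_wpM2r//; lra.
lra.
Qed.

(** A substitute for extracting a subsequence: along an ultrafilter every
    bounded real sequence converges, and equicontinuity with compactness turns
    pointwise into uniform convergence. *)
Lemma ultra_uniform_limit (R : realType) (X : topologicalType)
    (F : set_system nat) (B : R) (f : nat -> X -> R) :
  UltraFilter F -> compact [set: X] ->
  (forall n x, `|f n x| <= B) ->
  (forall x e, 0 < e -> \forall y \near x, forall n, `|f n x - f n y| <= e) ->
  exists2 g : X -> R, continuous g &
    forall e, 0 < e -> \forall n \near F, forall x, `|f n x - g x| <= e.
Proof.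
move=> FU cX fB feq.
have /choice[g gP] : forall x, exists l : R, f n x @[n --> F] --> l.
  move=> x.
  have [|l [_ ll]] := @segment_compact R (- B) B (f ^~ x @ F) _.
    by apply: (@filterE _ F) => n; rewrite /= in_itv /= -ler_norml.
  exists l => A nA; have [//|nfA] := in_ultra_setVsetC (f ^~ x @^-1` A) FU.
  by have [y []] := ll (~` A) A nfA nA.
have gmod x e : 0 < e -> \forall y \near x, `|g x - g y| <= e.
  move=> e0; near=> y.
  have fxy : forall n, `|f n x - f n y| <= e by near: y; exact: feq.
  have lim : (fun n => `|f n x - f n y|) @ F --> `|g x - g y|.
    by apply: cvg_norm; apply: cvgB; exact: gP.
  by apply: (closed_cvg (fun r => r <= e) (@closed_le R e)) lim; near=> n.
exists g.
  move=> x; apply/cvgrPdist_le => e; exact: gmod.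
move=> e e0.
have /compact_near_coveringP cov := cX.
have := cov _ F (fun n x => `|f n x - g x| <= e) _ _.
move=> H.
suff : \forall n \near F, [set: X] `<=` (fun x => `|f n x - g x| <= e).
  by apply: filterS => n h x; exact: h.
apply: H => x _.
have e30 : 0 < e / 3 by rewrite divr_gt0.
exists ([set y | (forall n, `|f n x - f n y| <= e / 3) /\ `|g x - g y| <= e / 3],
        [set n | `|g x - f n x| <= e / 3]).
  split=> /=.
    by apply: filterI; [exact: feq|exact: gmod].
  by have /cvgrPdist_le := gP x; apply.
move=> [y n] /= [[h1 h2] h3].
have -> : f n y - g y = - (f n x - f n y) - (g x - f n x) + (g x - g y) by ring.
apply: (le_trans (ler_normD _ _)); have := ler_normB (- (f n x - f n y)) (g x - f n x).
have := h1 n; rewrite normrN; lra.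
Unshelve. all: by end_near. Qed.

(** * Integration against an image of a density *)

Local Open Scope ereal_scope.

Section density_pushforward.
Context d d' (T : measurableType d) (U : measurableType d') (R : realType).
Variables (alpha : {measure set T -> \bar R}) (mu : {measure set U -> \bar R}).
Variables (D : set T) (b : T -> U) (r : T -> R).
Hypotheses (mD : measurable D) (mb : measurable_fun D b)
  (mr : measurable_fun D r) (r0 : forall y, (0 <= r y)%R)
  (muE : forall A, measurable A ->
    mu A = \int[alpha]_(y in D `&` b @^-1` A) (r y)%:E).

Import HBNNSimple.

(** The hypothesis is the case where [f] is an indicator; simple functions
    and monotone convergence give the rest.  The map [b] is only measurable on [D],
    as is the base point of a cone off the apex. *)
Lemma integral_density_pushforward (f : U -> \bar R) :
  measurable_fun setT f -> (forall x, 0 <= f x) ->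
  \int[mu]_x f x = \int[alpha]_(y in D) (f (b y) * (r y)%:E).
Proof.
move=> mf f0; pose h := nnsfun_approx measurableT mf.
have mhb n : measurable_fun D (h n \o b).
  exact: (@measurable_comp _ _ _ _ _ _ setT).
have mrE : measurable_fun D (EFin \o r) by exact/measurable_EFinP.
have -> : \int[mu]_x f x = limn (fun n => \int[mu]_x (EFin \o h n) x).
  rewrite -monotone_convergence//.
  - by apply: eq_integral => x _; apply/esym/cvg_lim => //; exact: cvg_nnsfun_approx.
  - by move=> n; exact/measurable_EFinP/measurable_funP.
  - by move=> n x _; rewrite lee_fin.
  - by move=> x _ m n mn; rewrite lee_fin; exact/lefP/nd_nnsfun_approx.
have -> : \int[alpha]_(y in D) (f (b y) * (r y)%:E) =
    limn (fun n => \int[alpha]_(y in D) ((h n (b y))%:E * (r y)%:E)).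
  rewrite -monotone_convergence//.
  - apply: eq_integral => y _; apply/esym/cvg_lim => //.
    by apply: cvgeZr => //; exact: cvg_nnsfun_approx.
  - by move=> n; apply: emeasurable_funM => //; exact/measurable_EFinP/mhb.
  - by move=> n y _; rewrite mule_ge0 ?lee_fin.
  - move=> y _ m n mn; rewrite lee_wpmul2r ?lee_fin//.
    exact/lefP/nd_nnsfun_approx.
congr (limn _); apply/funext => n.
have mset s : measurable (h n @^-1` [set s]).
  by rewrite -[X in measurable X]setTI; exact: measurable_funP.
transitivity (\sum_(s \in range (h n)) (s%:E * mu (h n @^-1` [set s]))).
  by rewrite integralT_nnsfun sintegralE.
transitivity (\int[alpha]_(y in D) (\sum_(s \in range (h n))
    (s * \1_(h n @^-1` [set s]) (b y))%:E * (r y)%:E)); last first.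
  apply: eq_integral => y _; rewrite -ge0_mule_fsuml => [|s]; last first.
    exact: nnfun_muleindic_ge0.
  by rewrite fsumEFin// -fimfunE.
rewrite ge0_integral_fsum//; last 2 first.
  - move=> s; apply: emeasurable_funM => //; apply/measurable_EFinP.
    apply: measurable_funM => //.
    by apply: (@measurable_comp _ _ _ _ _ _ setT).
  - by move=> s y _; rewrite EFinM mule_ge0 ?nnfun_muleindic_ge0 ?lee_fin.
apply: eq_fsbigr => s; rewrite inE => -[t _ <-].
under [RHS]eq_integral do rewrite EFinM -muleA.
rewrite ge0_integralZl//; last 3 first.
- apply: emeasurable_funM => //; apply/measurable_EFinP.
  exact: (@measurable_comp _ _ _ _ _ _ setT).
- by move=> y _; rewrite mule_ge0 ?lee_fin.
- by rewrite lee_fin.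
congr (_ * _); rewrite muE// integral_mkcondr.
apply: eq_integral => y _.
rewrite patchE indicE; have [/= yA|/= yA] := boolP (y \in b @^-1` _).
  by rewrite mem_set ?mul1e//; move: yA; rewrite inE.
by rewrite memNset ?mul0e//; move: yA; rewrite notin_setE.
Qed.

End density_pushforward.

Local Close Scope ereal_scope.

(** * Borel measurability on spaces and products *)

Lemma open_setI_preimage (T U : topologicalType) (D : set T) (f : T -> U)
    (O : set U) :
  open D -> (forall x, D x -> {for x, continuous f}) -> open O ->
  open (D `&` f @^-1` O).
Proof.
move=> oD cf oO; rewrite openE => x [Dx Ofx].
apply: filterI; first exact: open_nbhs_nbhs.
by apply: cf => //; exact: open_nbhs_nbhs.
Qed.

Lemma open_borel (T : ptopologicalType) (O : set T) :
  open O -> measurable (O : set (borel T)).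
Proof. exact: sub_sigma_algebra. Qed.

Section measurable_borel.
Variables (T : ptopologicalType) (D : set T).
Hypothesis oD : open D.

Lemma borel_measurable_fun (U : ptopologicalType) (f : T -> U) :
  (forall x, D x -> {for x, continuous f}) ->
  measurable_fun (D : set (borel T)) (f : borel T -> borel U).
Proof.
move=> cf; apply: (@measurability _ _ (borel T) (borel U) D f (@open U)) => //.
move=> _ [B oB <-]; by apply: open_borel; exact: open_setI_preimage.
Qed.

Lemma real_measurable_fun (R : realType) (f : T -> R) :
  (forall x, D x -> {for x, continuous f}) ->
  measurable_fun (D : set (borel T)) (f : borel T -> R).
Proof.
move=> cf; apply: (measurability _ (RGenOInfty.measurableE R)) => _ [B [r ->] <-].
apply: open_borel; apply: open_setI_preimage => //.
Qed.

Lemma ereal_measurable_fun (R : realType) (f : T -> \bar R) :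
  (forall x, D x -> {for x, continuous f}) ->
  measurable_fun (D : set (borel T)) (f : borel T -> \bar R).
Proof.
move=> cf; apply: (measurability _ (ErealGenOInfty.measurableE R)) => _ [B [r ->] <-].
apply: open_borel; apply: open_setI_preimage => //.
by rewrite set_itvE; exact: open_ereal_gt_ereal.
Qed.

End measurable_borel.

Section compact_metrizable.
Variables (R : realType) (X : ptopologicalType).
Hypotheses (cX : compact [set: X]) (mX : metrizable R X).

(** The members of the base are indexed by the inverse radius and by the
    centres of a finite net for that radius. *)
Lemma countable_open_base : exists (D : nat -> {fset X}) (V : nat -> X -> set X),
  (forall n c, open (V n c)) /\
  forall x A, nbhs x A -> exists n c, [/\ c \in D n, V n c x & V n c `<=` A].
Proof.
have [d [d0 dC dD dN]] := mX.
pose V n c := [set y | d c y < n.+1%:R^-1].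
have oV n c : open (V n c) by exact: (metric_ball_open dC dD dN).
have /choice[D DP] : forall n, exists D : {fset X},
    [set: X] `<=` cover [set` D] (V n).
  move=> n; have := cX; rewrite compact_cover => /(_ X setT (V n)).
  case=> // [x _|D _ Dcov]; last by exists D.
  by exists x => //; rewrite /V /= (metric_refl d0) invr_gt0.
exists D, V; split=> // x A /dN[e e0 eA].
have e20 : 0 < e / 2 by rewrite divr_gt0.
have [n ne] : exists n, n.+1%:R^-1 < e / 2.
  by have [n _ /(_ n (leqnn n))] := near_infty_natSinv_lt (PosNum e20); exists n.
have [c cD cx] := DP n x I.
exists n, c; split => // y cy; apply: eA => /=.
have := dD x c y; rewrite (dC x c).
have := lt_trans cx ne; have := lt_trans cy ne; lra.
Qed.

End compact_metrizable.

Section product.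
Variables (R : realType) (X1 X2 : ptopologicalType).
Hypotheses (cX1 : compact [set: X1]) (mX1 : metrizable R X1)
  (cX2 : compact [set: X2]) (mX2 : metrizable R X2).

(** An open set of the product is the union, over a countable base of the
    second factor, of the largest rectangles it contains. *)
Lemma open_prod_measurable (O : set (X1 * X2)) :
  open O -> measurable (O : set (borel X1 * borel X2)%type).
Proof.
move=> oO; have [D [V [oV baseV]]] := countable_open_base cX2 mX2.
pose W n c := \bigcup_(U in [set U : set X1 | open U /\ U `*` V n c `<=` O]) U.
have -> : O = \bigcup_n \bigcup_(c in [set` D n]) (W n c `*` V n c).
  apply/seteqP; split=> [[x y] Oxy|[x y] [n _] [c _] [/= [U [_ UO] Ux] Vy]];
    last exact: UO.
  have [[A B] [/= nA nB] ABO] : nbhs (x, y) O by exact: open_nbhs_nbhs.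
  have [n [c [cD Vy VB]]] := baseV y B nB.
  exists n => //; exists c => //; split=> //=.
  move: nA; rewrite nbhsE => -[U [oU Ux] UA].
  exists U => //; split=> // -[x' y'] [/= /UA ? /VB ?]; exact: ABO.
apply: bigcup_measurable => n _; apply: fin_bigcup_measurable => // c _.
by apply: measurableX; apply: open_borel => //; apply: bigcup_open => U [].
Qed.

Lemma prod_borel_measurable_fun (U : ptopologicalType) (f : X1 * X2 -> U) :
  continuous f ->
  measurable_fun setT (f : (borel X1 * borel X2)%type -> borel U).
Proof.
move=> cf.
apply: (@measurability _ _ (borel X1 * borel X2)%type (borel U) setT f (@open U)) => //.
move=> _ [B oB <-]; rewrite setTI; apply: open_prod_measurable; exact: open_comp.
Qed.

Lemma prod_real_measurable_fun (f : X1 * X2 -> R) :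
  continuous f ->
  measurable_fun setT (f : (borel X1 * borel X2)%type -> R).
Proof.
move=> cf; apply: (measurability _ (RGenOInfty.measurableE R)) => _ [B [r ->] <-].
rewrite setTI; apply: open_prod_measurable; apply: open_comp => //.
Qed.

Lemma prod_hausdorff : hausdorff_space (X1 * X2)%type.
Proof.
move=> [x1 x2] [y1 y2] cxy; congr pair.
  apply: (metrizable_hausdorff mX1) => A B nA nB.
  have [z []] := cxy (fst @^-1` A) (fst @^-1` B) (cvg_fst nA) (cvg_fst nB).
  by exists z.1.
apply: (metrizable_hausdorff mX2) => A B nA nB.
have [z []] := cxy (snd @^-1` A) (snd @^-1` B) (cvg_snd nA) (cvg_snd nB).
by exists z.2.
Qed.

End product.

(** * Regularity of the product measure *)

Local Open Scope ereal_scope.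

Section product_radon.
Variables (R : realType) (X1 X2 : ptopologicalType).
Hypotheses (cX1 : compact [set: X1]) (mX1 : metrizable R X1)
  (cX2 : compact [set: X2]) (mX2 : metrizable R X2).
Local Notation Z := (borel X1 * borel X2)%type.
Variable nu : {finite_measure set Z -> \bar R}.

Definition inner_regular (D : set Z) : Prop :=
  forall e : R, (0 < e)%R ->
    exists K : set (X1 * X2), [/\ compact K, K `<=` D & nu (D `\` K) < e%:E].

Lemma closed_prod_measurable (K : set (X1 * X2)) :
  closed K -> measurable (K : set Z).
Proof.
move=> cK; rewrite -(setCK K); apply: measurableC.
apply: (open_prod_measurable cX2 mX2); exact: closed_openC.
Qed.

Lemma compact_prod_closed (K : set (X1 * X2)) : compact K -> closed K.
Proof. exact: (compact_closed (prod_hausdorff mX1 mX2)). Qed.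

Lemma compact_prod_measurable (K : set (X1 * X2)) :
  compact K -> measurable (K : set Z).
Proof. by move=> /compact_prod_closed; exact: closed_prod_measurable. Qed.

Lemma inner_regular_choice (D : nat -> set Z) (e : R) : (0 < e)%R ->
  (forall n, inner_regular (D n)) ->
  exists K : nat -> set (X1 * X2), forall n,
    [/\ compact (K n), K n `<=` D n &
        nu (D n `\` K n) < (e / (2 ^ n.+1)%:R)%:E].
Proof.
move=> e0 regD.
suff /choice[K KP] : forall n, exists K : set (X1 * X2),
    [/\ compact K, K `<=` D n & nu (D n `\` K) < (e / (2 ^ n.+1)%:R)%:E].
  by exists K.
by move=> n; apply: regD; rewrite divr_gt0// ltr0n expn_gt0.
Qed.

Lemma nu_series_lt (A : nat -> set Z) (B : set Z) (e : R) : (0 < e)%R ->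
  (forall n, measurable (A n)) -> measurable B -> B `<=` \bigcup_n A n ->
  (forall n, nu (A n) < (e / (2 ^ n.+1)%:R)%:E) -> nu B <= e%:E.
Proof.
move=> e0 mA mB BA Ae.
have h : nu B <= \sum_(n <oo) nu (A n) by exact: measure_sigma_subadditive.
apply: (le_trans h).
apply: (le_trans _ (epsilon_trick0 xpredT (ltW e0))).
by apply: lee_nneseries => // n _; exact: ltW.
Qed.

(** Continuity from above makes a finite union of the approximating compact
    sets sufficient. *)
Lemma inner_regular_bigcup (D : nat -> set Z) :
  (forall n, measurable (D n)) -> (forall n, inner_regular (D n)) ->
  inner_regular (\bigcup_n D n).
Proof.
move=> mD regD e e0; have e20 : (0 < e / 2)%R by rewrite divr_gt0.
have [K KP] := inner_regular_choice e20 regD.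
have cK n : compact (K n) by have [] := KP n.
have mK n : measurable (K n : set Z) by exact: compact_prod_measurable.
pose L N : set Z := \big[setU/set0]_(i < N) K i.
have mL N : measurable (L N) by exact: bigsetU_measurable.
pose F N := (\bigcup_n D n) `\` L N.
have mF N : measurable (F N) by apply: measurableD => //; exact: bigcupT_measurable.
have capF : \bigcap_N F N `<=` \bigcup_n (D n `\` K n).
  move=> z Fz; have [[n _ Dz] _] := Fz 0%N I.
  exists n => //; split=> // Kz; have [_] := Fz n.+1 I; apply.
  by rewrite /L -bigcup_mkord; exists n => //=.
have mcapF : measurable (\bigcap_N F N) by exact: bigcapT_measurable.
have Flt : nu (\bigcap_N F N) <= (e / 2)%:E.
  apply: (nu_series_lt e20 _ mcapF capF) => [n|n].
    by apply: measurableD.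
  by have [] := KP n.
have Fdec : nonincreasing_seq F.
  move=> m n mn; apply/subsetPset => z [Dz nLz]; split=> // Lz; apply: nLz.
  move: Lz; rewrite /L -!bigcup_mkord => -[i /= im Kz]; exists i => //=.
  exact: leq_trans im mn.
have finF : nu (F 0%N) < +oo by rewrite ltey_eq fin_num_measure.
have cvgF := nonincreasing_cvg_mu finF mF mcapF Fdec.
have [N _ NF] : \forall N \near \oo, nu (F N) < e%:E.
  apply: (cvgF [set x | x < e%:E]); apply: open_nbhs_nbhs; split => /=.
    exact: open_ereal_lt_ereal.
  by apply: (le_lt_trans Flt); rewrite lte_fin; lra.
exists (L N); split.
- exact: bigsetU_compact.
- move=> z; rewrite /L -bigcup_mkord => -[i _ Kz]; exists i => //.
  by have [_ KD _] := KP i; exact: KD.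
- exact: (NF N (leqnn N)).
Qed.

Lemma inner_regular_bigcap (D : nat -> set Z) :
  (forall n, measurable (D n)) -> (forall n, inner_regular (D n)) ->
  inner_regular (\bigcap_n D n).
Proof.
move=> mD regD e e0; have e20 : (0 < e / 2)%R by rewrite divr_gt0.
have [K KP] := inner_regular_choice e20 regD.
have cK n : compact (K n) by have [] := KP n.
have mK n : measurable (K n : set Z) by exact: compact_prod_measurable.
have cI : closed (\bigcap_n K n).
  by apply: closed_bigI => n _; exact: compact_prod_closed.
exists (\bigcap_n K n); split.
- by apply: (subclosed_compact cI (cK 0%N)) => z; apply.
- by move=> z Kz n _; have [_ KD _] := KP n; exact/KD/Kz.
- apply: (@le_lt_trans _ _ (e / 2)%:E); last by rewrite lte_fin; lra.
  apply: (@nu_series_lt (fun n => D n `\` K n)) => // [n| |z [Dz]|n].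
  + exact: measurableD.
  + apply: measurableD; first exact: bigcapT_measurable.
    exact: closed_prod_measurable.
  + move=> /existsNP[n /not_implyP[_ nKz]]; exists n => //; split=> //.
    exact: Dz.
  + by have [] := KP n.
Qed.

(** The sets that are inner regular together with their complement form a
    sigma-algebra; carrying the complement along replaces outer regularity. *)
Lemma inner_regular_prod :
  (forall A : set (borel X1), measurable A -> inner_regular (fst @^-1` A)) ->
  (forall A : set (borel X2), measurable A -> inner_regular (snd @^-1` A)) ->
  forall D, measurable D -> inner_regular D.
Proof.
move=> reg1 reg2.
pose good : set (set Z) :=
  [set D | [/\ measurable D, inner_regular D & inner_regular (~` D)]].
suff sub : @measurable _ Z `<=` good by move=> D /sub[].
apply: smallest_sub.
  split.
  - split=> // [e e0|].
      by exists set0; split; [exact: compact0| |rewrite set0D measure0 lte_fin].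
    have := reg1 _ measurableT; rewrite preimage_setT.
    by rewrite setC0.
  - move=> A [mA rA rCA]; rewrite setTD; split=> //; first exact: measurableC.
    by rewrite setCK.
  - move=> D gD; split.
    + by apply: bigcupT_measurable => n; have [] := gD n.
    + by apply: inner_regular_bigcup => n; have [] := gD n.
    + rewrite setC_bigcup; apply: inner_regular_bigcap => n; last by have [] := gD n.
      by apply: measurableC; have [] := gD n.
move=> D [[A mA]|[A mA]]; rewrite setTI => <-.
  split; [|exact: reg1|rewrite preimage_setC; apply: reg1; exact: measurableC].
  by rewrite -[X in measurable X]setTI; exact: measurable_fst.
split; [|exact: reg2|rewrite preimage_setC; apply: reg2; exact: measurableC].
by rewrite -[X in measurable X]setTI; exact: measurable_snd.
Qed.

End product_radon.

Section finite_product.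
Context (R : realType) d1 d2 (T1 : measurableType d1) (T2 : measurableType d2).
Variables (mu1 : {finite_measure set T1 -> \bar R})
  (mu2 : {finite_measure set T2 -> \bar R}).

(** The product measure of two finite measures, with the structure of a finite
    measure. *)
Definition finite_product : set (T1 * T2) -> \bar R := mu1 \x mu2.

HB.instance Definition _ := Measure.on finite_product.

Let finite_product_fin : fin_num_fun finite_product.
Proof.
move=> A mA; rewrite ge0_fin_numE//.
apply: (@le_lt_trans _ _ (finite_product setT)).
  by apply: le_measure; rewrite ?inE.
rewrite -setXTT /finite_product product_measure1E// ltey_eq fin_numM//;
  exact: fin_num_measure.
Qed.

HB.instance Definition _ :=
  Measure_isFinite.Build _ _ _ finite_product finite_product_fin.

End finite_product.

Section finite_of_measure.
Context (R : realType) d (T : measurableType d).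
Variables (m : {measure set T -> \bar R}) (fin_m : fin_num_fun m).

Definition finite_of_measure & fin_num_fun m : set T -> \bar R := m.

HB.instance Definition _ := Measure.on (finite_of_measure fin_m).
HB.instance Definition _ :=
  Measure_isFinite.Build _ _ _ (finite_of_measure fin_m) fin_m.

End finite_of_measure.

Section finite_pushforward.
Context (R : realType) d d' (T : measurableType d) (U : measurableType d').
Variables (mu : {finite_measure set T -> \bar R}) (f : T -> U)
  (mf : measurable_fun setT f).

Lemma finite_pushforward :
  exists nu : {finite_measure set U -> \bar R},
    nu = pushforward mu f :> (set U -> \bar R).
Proof.
have fin : fin_num_fun (pushforward mu f).
  move=> A mA; rewrite /pushforward; apply: fin_num_measure.
  by rewrite -[X in measurable X]setTI; exact: mf.
have [m mE] : exists m : {measure set U -> \bar R},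
    m = pushforward mu f :> (set U -> \bar R).
  by unshelve refine (ex_intro _ (pushforward mu f : {measure set U -> \bar R}) _).
rewrite -mE in fin *.
by exists (finite_of_measure fin).
Qed.

End finite_pushforward.

Local Close Scope ereal_scope.

(** * Topology of the cone *)

Section cone_topology.
Variables (R : realType) (X : ptopologicalType).

Lemma cone_nbhs_apexE (y : cone R X) A : cone_radius y = 0 ->
  nbhs y A = exists2 e, 0 < e & [set z | cone_radius z < e] `<=` A.
Proof. by move=> y0; rewrite /nbhs /= /cone_nbhs y0 eqxx. Qed.

Lemma cone_nbhs_posE (y : cone R X) A : cone_radius y != 0 ->
  nbhs y A = exists2 N, nbhs ((cone_base y, cone_radius y) : X * R) N &
    forall x (s : {nonneg R}), N (x, s%:num) -> A (cone_class x s).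
Proof. by move=> y0; rewrite /nbhs /= /cone_nbhs (negPf y0). Qed.

(** The absolute value makes the polar parametrization total on the real line;
    it is harmless for nonnegative radii. *)
Lemma cone_class_continuous :
  continuous (fun p : X * R => cone_class p.1 `|p.2|%:nng : cone R X).
Proof.
move=> [x r] A /=; have [r0|r0] := eqVneq `|r| 0.
  rewrite cone_nbhs_apexE ?cone_radiusE// => -[e e0 eA].
  have : \forall p \near (x, r), `|p.2| < e.
    have cn : (fun p : X * R => `|p.2|) @ (x, r) --> `|r|.
      by apply: cvg_norm; exact: cvg_snd.
    by apply: (cn [set s | s < e]); rewrite /= r0; exact: lt_nbhsl.
  by apply: filterS => p pe; apply: eA; rewrite /= cone_radiusE.
rewrite cone_nbhs_posE ?cone_radiusE// cone_baseE ?lt_def ?r0//= => -[N nN NA].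
have cn : (fun p : X * R => (p.1, `|p.2|)) @ (x, r) --> (x, `|r|).
  apply: (@continuous_pair _ _ _ fst (fun p : X * R => `|p.2|)).
    exact: cvg_fst.
  by apply: cvg_norm; exact: cvg_snd.
have : \forall p \near (x, r), N (p.1, `|p.2|).
  by exact: (cn N).
by apply: filterS => p Np; exact: NA.
Qed.

Lemma cone_radius_continuous : continuous (@cone_radius R X).
Proof.
move=> y; have ? : Filter (cone_nbhs y) := nbhs_filter y.
apply/cvgrPdist_lt => e e0.
suff h : nbhs y [set z | `|cone_radius y - cone_radius z| < e] by exact: h.
have [y0|y0] := eqVneq (cone_radius y) 0.
  rewrite cone_nbhs_apexE//; exists e => // z /= ze.
  by rewrite y0 sub0r normrN ger0_norm ?cone_radius_ge0.
rewrite cone_nbhs_posE//.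
exists [set p | `|cone_radius y - p.2| < e].
  have : (fun p : X * R => p.2) @ (cone_base y, cone_radius y) --> cone_radius y.
    exact: cvg_snd.
  by move=> /cvgrPdist_lt; apply.
by move=> x s /=; rewrite cone_radiusE.
Qed.

Lemma cone_base_continuous (y : cone R X) : 0 < cone_radius y ->
  {for y, continuous (@cone_base R X)}.
Proof.
move=> y0 A nA; rewrite /= /nbhs /= /cone_nbhs gt_eqF//.
exists (A `*` [set r | 0 < r]).
  exists (A, [set r | 0 < r]) => //; split=> //=.
  exact: lt_nbhsr.
by move=> x s [/= Ax s0]; rewrite cone_baseE.
Qed.

Lemma cone_radius_eq0 (y : cone R X) : cone_radius y = 0 -> y = apex.
Proof.
have [x [r ->]] := coneP y; rewrite cone_radiusE => r0.
by rewrite -(cone_apexE R x); congr cone_class; exact/val_inj.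
Qed.

End cone_topology.

Section cone_product.
Variables (R : realType) (X1 X2 : ptopologicalType).
Local Notation C := (cone R X1 * cone R X2)%type.

Lemma rad1_continuous : continuous (@rad1 R X1 X2).
Proof.
move=> y; apply: (@continuous_comp _ _ _ fst); first exact: cvg_fst.
exact: cone_radius_continuous.
Qed.

Lemma rad2_continuous : continuous (@rad2 R X1 X2).
Proof.
move=> y; apply: (@continuous_comp _ _ _ snd); first exact: cvg_snd.
exact: cone_radius_continuous.
Qed.

Lemma base1_continuous (y : C) : 0 < rad1 y -> {for y, continuous (@base1 R X1 X2)}.
Proof.
move=> y0; apply: (@continuous_comp _ _ _ fst); first exact: cvg_fst.
exact: cone_base_continuous.
Qed.

Lemma base2_continuous (y : C) : 0 < rad2 y -> {for y, continuous (@base2 R X1 X2)}.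
Proof.
move=> y0; apply: (@continuous_comp _ _ _ snd); first exact: cvg_snd.
exact: cone_base_continuous.
Qed.

(** Polar coordinates on the product of the cones, for arbitrary real radii. *)
Definition polar (p : (X1 * X2) * (R * R)) : C :=
  (cone_class p.1.1 `|p.2.1|%:nng, cone_class p.1.2 `|p.2.2|%:nng).

Lemma polar_continuous : continuous polar.
Proof.
have c1 (p : (X1 * X2) * (R * R)) :
    (fun p => (p.1.1, p.2.1)) @ p --> (p.1.1, p.2.1).
  apply: (@continuous_pair _ _ _ (fun p => p.1.1) (fun p => p.2.1)).
    by apply: (@continuous_comp _ _ _ fst fst); exact: cvg_fst.
  by apply: (@continuous_comp _ _ _ snd fst); [exact: cvg_snd|exact: cvg_fst].
have c2 (p : (X1 * X2) * (R * R)) :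
    (fun p => (p.1.2, p.2.2)) @ p --> (p.1.2, p.2.2).
  apply: (@continuous_pair _ _ _ (fun p => p.1.2) (fun p => p.2.2)).
    by apply: (@continuous_comp _ _ _ fst snd); [exact: cvg_fst|exact: cvg_snd].
  by apply: (@continuous_comp _ _ _ snd snd); exact: cvg_snd.
move=> p; apply: continuous_pair.
  apply: (@continuous_comp _ _ _ (fun p => (p.1.1, p.2.1))
    (fun p => cone_class p.1 `|p.2|%:nng) p (c1 p)).
  exact: cone_class_continuous.
apply: (@continuous_comp _ _ _ (fun p => (p.1.2, p.2.2))
  (fun p => cone_class p.1 `|p.2|%:nng) p (c2 p)).
exact: cone_class_continuous.
Qed.

Lemma polar_neq_apex p : p.2 != (0, 0) -> polar p <> (apex, apex).
Proof.
case: p => -[x1 x2] [r1 r2] /= r0 [h1 h2].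
move: (congr1 (@cone_radius R X1) h1) (congr1 (@cone_radius R X2) h2).
rewrite /apex !cone_radiusE /= => /normr0_eq0 r1E /normr0_eq0 r2E.
by move: r0; rewrite r1E r2E eqxx.
Qed.

Lemma open_neq_apex : open [set y : C | y <> (apex, apex)].
Proof.
have -> : [set y : C | y <> (apex, apex)] =
    (fun y => rad1 y + rad2 y) @^-1` [set r | 0 < r].
  apply/seteqP; split=> [y yN|y /= y0 yE]; last first.
    by move: y0; rewrite yE /rad1 /rad2 /apex !cone_radiusE /= addr0 ltxx.
  rewrite /= lt_def addr_ge0 ?cone_radius_ge0// andbT.
  apply/negP; rewrite paddr_eq0 ?cone_radius_ge0// => /andP[/eqP y1 /eqP y2].
  by apply: yN; case: y y1 y2 => a b /cone_radius_eq0 /= -> /cone_radius_eq0 /= ->.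
apply: open_comp; last exact: open_gt.
move=> y _; apply: cvgD; [exact: rad1_continuous|exact: rad2_continuous].
Qed.

(** Continuity off one closed point is enough for Borel measurability. *)
Lemma cost_measurable (H : C -> \bar R) :
  (forall y, y <> (apex, apex) -> {for y, continuous H}) ->
  measurable_fun setT (H : borel C -> \bar R).
Proof.
move=> cH; have oU := open_neq_apex.
have -> : [set: borel C] = [set y | y <> (apex, apex)] `|` [set (apex, apex)].
  apply/seteqP; split=> // y _.
  by have [->|yN] := pselect (y = (apex, apex)); [right|left].
have mU : measurable ([set y | y <> (apex, apex)] : set (borel C)) by exact: open_borel.
have m1 : measurable ([set (apex, apex)] : set (borel C)).
  rewrite -[X in measurable X]setCK; apply: measurableC.
  by rewrite (_ : ~` _ = [set y | y <> (apex, apex)]).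
apply/measurable_funU => //; split; last exact: measurable_fun_set1.
exact: ereal_measurable_fun.
Qed.

End cone_product.

(** * Couplings given by continuous densities *)

Local Open Scope ereal_scope.

Section radius_and_base.
Variables (R : realType) (T X : ptopologicalType) (r : T -> R) (b : T -> X).
Hypotheses (cr : continuous r)
  (cb : forall y, (0 < r y)%R -> {for y, continuous b}).

Lemma open_gt0 : open [set y | (0 < r y)%R].
Proof.
rewrite (_ : [set y | (0 < r y)%R] = r @^-1` [set s | (0 < s)%R])//.
by apply: open_comp; [move=> y _; exact: cr|exact: open_gt].
Qed.

Lemma measurable_gt0 : measurable ([set y | (0 < r y)%R] : set (borel T)).
Proof. by apply: open_borel; exact: open_gt0. Qed.

Lemma continuous_real_measurable : measurable_fun setT (r : borel T -> R).
Proof. by apply: real_measurable_fun; [exact: openT|move=> y _; exact: cr]. Qed.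

Lemma measurable_base :
  measurable_fun ([set y | (0 < r y)%R] : set (borel T)) (b : borel T -> borel X).
Proof. exact: (borel_measurable_fun open_gt0). Qed.

End radius_and_base.

Section marginals.
Context (R : realType) d1 d2 (T1 : measurableType d1) (T2 : measurableType d2).
Variables (mu1 : {finite_measure set T1 -> \bar R})
  (mu2 : {finite_measure set T2 -> \bar R}).
Variable a : T1 * T2 -> R.
Hypotheses (ma : measurable_fun setT a) (a0 : forall x, (0 <= a x)%R).

Lemma integral_fst_preimage A :
  measurable A -> (forall x, \int[mu2]_y (a (x, y))%:E = 1) ->
  \int[finite_product mu1 mu2]_(x in fst @^-1` A) (a x)%:E = mu1 A.
Proof.
move=> mA a1; have mfA : measurable (fst @^-1` A : set (T1 * T2)).
  by rewrite -[X in measurable X]setTI; exact: measurable_fst.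
rewrite integral_mkcond fubini_tonelli1; last 2 first.
- apply/(measurable_restrictT _ mfA); apply/measurable_EFinP.
  exact: measurable_funTS.
- by move=> x; apply: erestrict_ge0 => y _; rewrite lee_fin.
rewrite (_ : mu1 A = \int[mu1]_x (\1_A x)%:E); last by rewrite integral_indic// setIT.
apply: eq_integral => x _; rewrite /fubini_F indicE.
have [xA|xA] := boolP (x \in A).
  rewrite -[RHS](a1 x); apply: eq_integral => y _.
  by rewrite patchE mem_set//; move: xA; rewrite inE.
rewrite integral0_eq// => y _.
by rewrite patchE memNset//; move: xA; rewrite notin_setE.
Qed.

Lemma integral_snd_preimage A :
  measurable A -> (forall y, \int[mu1]_x (a (x, y))%:E = 1) ->
  \int[finite_product mu1 mu2]_(x in snd @^-1` A) (a x)%:E = mu2 A.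
Proof.
move=> mA a1; have mfA : measurable (snd @^-1` A : set (T1 * T2)).
  by rewrite -[X in measurable X]setTI; exact: measurable_snd.
rewrite integral_mkcond fubini_tonelli2; last 2 first.
- apply/(measurable_restrictT _ mfA); apply/measurable_EFinP.
  exact: measurable_funTS.
- by move=> x; apply: erestrict_ge0 => y _; rewrite lee_fin.
rewrite (_ : mu2 A = \int[mu2]_x (\1_A x)%:E); last by rewrite integral_indic// setIT.
apply: eq_integral => y _; rewrite /fubini_G indicE.
have [yA|yA] := boolP (y \in A).
  rewrite -[RHS](a1 y); apply: eq_integral => x _.
  by rewrite patchE mem_set//; move: yA; rewrite inE.
rewrite integral0_eq// => x _.
by rewrite patchE memNset//; move: yA; rewrite notin_setE.
Qed.

End marginals.

Section coupling.
Variables (R : realType) (X1 X2 : ptopologicalType).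
Hypotheses (cX1 : compact [set: X1]) (mX1 : metrizable R X1)
  (cX2 : compact [set: X2]) (mX2 : metrizable R X2).
Variables (mu1 : {finite_measure set (borel X1) -> \bar R})
  (mu2 : {finite_measure set (borel X2) -> \bar R}).
Hypotheses (radon1 : radon X1 mu1) (radon2 : radon X2 mu2).
Local Notation Z := (borel X1 * borel X2)%type.
Local Notation C := (cone R X1 * cone R X2)%type.
Local Notation nu := (finite_product mu1 mu2).

Lemma compact_borel (X : ptopologicalType) (K : set X) :
  metrizable R X -> compact K -> measurable (K : set (borel X)).
Proof.
move=> mX cK; rewrite -(setCK K); apply: measurableC; apply: open_borel.
apply: closed_openC; apply: compact_closed => //; exact: metrizable_hausdorff mX.
Qed.

Lemma small_mass (e : R) (x m : \bar R) :
  m \is a fin_num -> 0 <= m -> (0 < e)%R -> 0 <= x ->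
  x < (e / (fine m + 1))%:E -> x * m < e%:E.
Proof.
case: m => [m| |] // _; rewrite lee_fin => m0 e0.
case: x => [x| |] //; rewrite lee_fin lte_fin => x0 xe.
rewrite -EFinM lte_fin.
have m1 : (0 < m + 1)%R by lra.
have h : (x * (m + 1) < e)%R by rewrite -ltr_pdivlMr.
apply: (le_lt_trans _ h); rewrite ler_wpM2l//; lra.
Qed.

(** For a cylinder over [A], the product of a compact subset of [A] with the
    whole other factor does. *)
Lemma product_radon D : measurable D -> inner_regular nu D.
Proof.
have fin1 : mu1 setT \is a fin_num by exact: fin_num_measure.
have fin2 : mu2 setT \is a fin_num by exact: fin_num_measure.
apply: inner_regular_prod => // A mA e e0.
  have m0 : (0 <= fine (mu2 setT))%R by exact: fine_ge0.
  have [|K [cK KA Ke]] := @radon1 _ mA (e / (fine (mu2 setT) + 1))%R _.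
    by rewrite divr_gt0//; lra.
  have mK : measurable (K : set (borel X1)) by exact: compact_borel.
  exists (K `*` setT); split; first exact: compact_setX.
    by move=> z [/KA].
  have -> : fst @^-1` A `\` K `*` [set: X2] = (A `\` K) `*` [set: borel X2].
    apply/seteqP; split=> -[x y] /=.
      by move=> [Ax nK]; split=> //; split=> //= Kx; exact: nK.
    by move=> [[Ax nK] _]; split=> // -[].
  have mAK : measurable (A `\` K : set (borel X1)) by exact: measurableD.
  apply: (@eq_ind_r _ _ (fun z => z < e%:E) _ _
    (product_measure1E mu1 mu2 mAK measurableT)).
  exact: small_mass.
have m0 : (0 <= fine (mu1 setT))%R by exact: fine_ge0.
have [|K [cK KA Ke]] := @radon2 _ mA (e / (fine (mu1 setT) + 1))%R _.
  by rewrite divr_gt0//; lra.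
have mK : measurable (K : set (borel X2)) by exact: compact_borel.
exists (setT `*` K); split; first exact: compact_setX.
  by move=> z [_ /KA].
have -> : snd @^-1` A `\` [set: X1] `*` K = [set: borel X1] `*` (A `\` K).
  apply/seteqP; split=> -[x y] /=.
    by move=> [Ay nK]; split=> //; split=> //= Ky; exact: nK.
  by move=> [_ [Ay nK]]; split=> // -[].
have mAK : measurable (A `\` K : set (borel X2)) by exact: measurableD.
apply: (@eq_ind_r _ _ (fun z => z < e%:E) _ _
  (product_measure1E mu1 mu2 measurableT mAK)).
by rewrite muleC; exact: small_mass.
Qed.

Variables a b : X1 * X2 -> R.
Hypotheses (ca : continuous a) (cb : continuous b)
  (a0 : forall x, (0 < a x)%R) (b0 : forall x, (0 < b x)%R)
  (a1 : forall x, \int[mu2]_y (a (x, y))%:E = 1)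
  (b1 : forall y, \int[mu1]_x (b (x, y))%:E = 1).

Let T x : C := polar (x, (a x, b x)).

Let cT : continuous T.
Proof.
move=> x; have c : (fun x => (x, (a x, b x))) @ x --> (x, (a x, b x)).
  apply: (@continuous_pair _ _ _ id (fun x => (a x, b x))); first exact: cvg_id.
  by apply: continuous_pair; [exact: ca|exact: cb].
apply: (@continuous_comp _ _ _ (fun x => (x, (a x, b x)))
  (@polar R X1 X2) x c).
exact: polar_continuous.
Qed.

Let rad1T x : rad1 (T x) = a x.
Proof. by rewrite /T /rad1 cone_radiusE /= gtr0_norm. Qed.

Let rad2T x : rad2 (T x) = b x.
Proof. by rewrite /T /rad2 cone_radiusE /= gtr0_norm. Qed.

Let base1T x : base1 (T x) = x.1.
Proof. by rewrite /T /base1 cone_baseE //= gtr0_norm. Qed.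

Let base2T x : base2 (T x) = x.2.
Proof. by rewrite /T /base2 cone_baseE //= gtr0_norm. Qed.

(** Here the coupling is the image [alpha] of the product measure under
    [x |-> ([x.1, a x], [x.2, b x])].  Its marginals come from Tonelli's theorem and
    the normalization of [a] and [b]; it is Radon because this map is continuous and,
    [a] and [b] being positive, injective. *)
Lemma continuous_coupling : exists2 alpha, homogeneous_couplings mu1 mu2 alpha &
  forall (H : C -> \bar R) (G : X1 * X2 -> R), (forall y, 0 <= H y) ->
    measurable_fun setT (H : borel C -> \bar R) -> continuous G ->
    (forall x, H (polar (x, (a x, b x))) <= (G x)%:E) ->
    \int[alpha]_y H y <= \int[nu]_x (G x)%:E.
Proof.
have mT : measurable_fun setT (T : Z -> borel C).
  exact: (prod_borel_measurable_fun cX2 mX2).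
have [alpha alphaE] := finite_pushforward nu mT.
have int_alpha (D : set (borel C)) (f : borel C -> \bar R) :
    measurable D -> measurable_fun D f -> (forall y, 0 <= f y) ->
    \int[alpha]_(y in D) f y = \int[nu]_(x in T @^-1` D) f (T x).
  move=> mD mf f0.
  by rewrite alphaE ge0_integral_pushforward.
have mr1 := continuous_real_measurable (@rad1_continuous R X1 X2).
have mr2 := continuous_real_measurable (@rad2_continuous R X1 X2).
have mas : measurable_fun setT (a : Z -> R).
  exact: (prod_real_measurable_fun cX2 mX2).
have mbs : measurable_fun setT (b : Z -> R).
  exact: (prod_real_measurable_fun cX2 mX2).
exists alpha; last first.
  move=> H G H0 mH cG HG; rewrite int_alpha// preimage_setT.
  apply: ge0_le_integral => //.
  - exact: (measurableT_comp mH mT).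
  - by apply/measurable_EFinP; exact: (prod_real_measurable_fun cX2 mX2).
  - by move=> x _; exact: HG.
split.
- move=> A mA e e0.
  have mTA : measurable (T @^-1` A : set Z).
    by rewrite -[X in measurable X]setTI; exact: mT.
  have [K [cK KA Ke]] := product_radon mTA e0.
  exists (T @` K); split.
  + by apply: continuous_compact => //; exact: continuous_subspaceT.
  + by move=> _ [x Kx <-]; exact: KA.
  + rewrite alphaE /pushforward; apply: le_lt_trans Ke.
    have -> : T @^-1` (A `\` T @` K) = T @^-1` A `\` K.
      apply/seteqP; split=> [x [Ax nK]|x [Ax nK]]; split=> //.
      move=> [x' Kx' TT]; apply: nK.
      rewrite (surjective_pairing x) -base1T -base2T -TT base1T base2T.
      by rewrite -surjective_pairing.
    by [].
- rewrite int_alpha// ?preimage_setT; last 2 first.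
  + by apply/measurable_EFinP; exact: measurable_funD.
  + by move=> y; rewrite lee_fin addr_ge0// cone_radius_ge0.
  under eq_integral do rewrite rad1T rad2T EFinD.
  rewrite ge0_integralD//; last 4 first.
  + by move=> x _; rewrite lee_fin ltW.
  + exact/measurable_EFinP.
  + by move=> x _; rewrite lee_fin ltW.
  + exact/measurable_EFinP.
  have /= <- := preimage_setT (@fst X1 X2).
  rewrite integral_fst_preimage//; last by move=> x; rewrite ltW.
  rewrite preimage_setT -(preimage_setT (@snd X1 X2)).
  rewrite integral_snd_preimage//; last by move=> x; rewrite ltW.
  by rewrite ltey_eq fin_numD !fin_num_measure.
- move=> A mA.
  have mD : measurable ([set y | (0 < rad1 y)%R /\ A (base1 y)] : set (borel C)).
    have mpos := measurable_gt0 (@rad1_continuous R X1 X2).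
    exact: (measurable_base (@rad1_continuous R X1 X2) (@base1_continuous R X1 X2)).
  rewrite int_alpha//; last 2 first.
  + by apply/measurable_EFinP; apply: measurable_funTS; exact: mr1.
  + by move=> y; rewrite lee_fin cone_radius_ge0.
  under eq_integral do rewrite rad1T.
  apply/esym; apply: etrans; last first.
    exact: (@integral_fst_preimage R _ _ _ _ mu1 mu2 a mas
      (fun x => ltW (a0 x)) A mA a1).
  congr (integral _ _ _); apply/seteqP; split=> x /=; rewrite base1T.
    by case.
  by rewrite rad1T a0.
- move=> A mA.
  have mD : measurable ([set y | (0 < rad2 y)%R /\ A (base2 y)] : set (borel C)).
    have mpos := measurable_gt0 (@rad2_continuous R X1 X2).
    exact: (measurable_base (@rad2_continuous R X1 X2) (@base2_continuous R X1 X2)).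
  rewrite int_alpha//; last 2 first.
  + by apply/measurable_EFinP; apply: measurable_funTS; exact: mr2.
  + by move=> y; rewrite lee_fin cone_radius_ge0.
  under eq_integral do rewrite rad2T.
  apply/esym; apply: etrans; last first.
    exact: (@integral_snd_preimage R _ _ _ _ mu1 mu2 b mbs
      (fun x => ltW (b0 x)) A mA b1).
  congr (integral _ _ _); apply/seteqP; split=> x /=; rewrite base2T.
    by case.
  by rewrite rad2T b0.
Qed.

End coupling.

Local Close Scope ereal_scope.

(** * Weak duality *)

Local Open Scope ereal_scope.

Lemma Cb_integrable (R : realType) (X : ptopologicalType)
    (mu : {finite_measure set (borel X) -> \bar R}) (f : X -> R) :
  Cb R X f -> mu.-integrable setT (EFin \o f : borel X -> \bar R).
Proof.
move=> [cf [M fM]]; apply: measurable_bounded_integrable => //.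
- by rewrite ltey_eq fin_num_measure.
- by apply: real_measurable_fun; [exact: openT|move=> x _; exact: cf].
- exists M; split; first exact: num_real.
  by move=> r Mr x _; exact: le_trans (fM x) (ltW Mr).
Qed.

Lemma integral_le_add2 (R : realType) d (T : measurableType d)
    (mu : {measure set T -> \bar R}) (f1 f2 k1 k2 h : T -> \bar R) :
  measurable_fun setT f1 -> measurable_fun setT f2 ->
  measurable_fun setT k1 -> measurable_fun setT k2 -> measurable_fun setT h ->
  (forall x, 0 <= f1 x) -> (forall x, 0 <= f2 x) ->
  (forall x, 0 <= k1 x) -> (forall x, 0 <= k2 x) -> (forall x, 0 <= h x) ->
  (forall x, f1 x + f2 x <= h x + (k1 x + k2 x)) ->
  \int[mu]_x f1 x + \int[mu]_x f2 x <=
  \int[mu]_x h x + (\int[mu]_x k1 x + \int[mu]_x k2 x).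
Proof.
move=> mf1 mf2 mk1 mk2 mh f10 f20 k10 k20 h0 le.
have mk : measurable_fun setT (fun x => k1 x + k2 x) by exact: emeasurable_funD.
have k0 x : 0 <= k1 x + k2 x by rewrite adde_ge0.
rewrite -!ge0_integralD//; apply: ge0_le_integral => //.
- by move=> x _; rewrite adde_ge0.
- exact: emeasurable_funD.
- exact: emeasurable_funD.
Qed.

(** The marginal condition, stated for sets in the definition of a homogeneous
    coupling, extends to continuous functions.  Where the radius vanishes the
    integrand is [0] whatever the base point is, so the integral over [r > 0] is an
    integral over the whole space. *)
Lemma integral_radius_base (R : realType) (T X : ptopologicalType)
    (r : T -> R) (b : T -> X) (alpha : {finite_measure set (borel T) -> \bar R})
    (mu : {finite_measure set (borel X) -> \bar R}) (f : X -> R) :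
  continuous r -> (forall y, (0 <= r y)%R) ->
  (forall y, (0 < r y)%R -> {for y, continuous b}) ->
  (forall A : set (borel X), measurable A ->
    mu A = \int[alpha]_(y in [set y | (0 < r y)%R /\ A (b y)]) (r y)%:E) ->
  continuous f -> (forall x, (0 <= f x)%R) ->
  measurable_fun setT (fun y : borel T => (f (b y) * r y)%:E) /\
  \int[mu]_x (f x)%:E = \int[alpha]_y (f (b y) * r y)%:E.
Proof.
move=> cr r0 cb muE cf f0.
pose D : set (borel T) := [set y | (0 < r y)%R].
have mD : measurable D by exact: measurable_gt0.
have mb : measurable_fun D (b : borel T -> borel X) by exact: measurable_base.
have mr : measurable_fun D (r : borel T -> R).
  by apply: measurable_funTS; exact: continuous_real_measurable.
have mf : measurable_fun setT (f : borel X -> R) by exact: continuous_real_measurable.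
have gE : (fun y : borel T => (f (b y) * r y)%:E) =
    (fun y => (f (b y) * r y)%:E) \_ D.
  apply/funext => y; rewrite patchE; case: ifPn => //.
  rewrite notin_setE /D /= => /negP; rewrite -leNgt => ry0.
  have -> : r y = 0%R by apply/eqP; rewrite eq_le ry0 r0.
  by rewrite mulr0.
have mg : measurable_fun D (fun y : borel T => (f (b y) * r y)%:E).
  apply/measurable_EFinP; apply: measurable_funM => //.
  by apply: (@measurable_comp _ _ _ (borel T) (borel X) R setT f D b).
split; first by rewrite gE; exact/(measurable_restrictT _ mD).
rewrite [in RHS]gE -integral_mkcond.
under [RHS]eq_integral do rewrite EFinM.
apply: (@integral_density_pushforward _ _ _ _ _ alpha mu D b r mD mb mr r0 _
  (EFin \o f)) => //.
exact/measurable_EFinP.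
Qed.

Section weak_duality.
Variables (R : realType) (X1 X2 : ptopologicalType).
Local Notation C := (cone R X1 * cone R X2)%type.
Variables (mu1 : {finite_measure set (borel X1) -> \bar R})
  (mu2 : {finite_measure set (borel X2) -> \bar R})
  (alpha : {finite_measure set (borel C) -> \bar R}).
Hypothesis alphaP : homogeneous_couplings mu1 mu2 alpha.
Variables (H : C -> \bar R).
Hypotheses (H0 : forall y, 0 <= H y)
  (mH : measurable_fun setT (H : borel C -> \bar R)).

Lemma Phi_le phi y : Phi_ H phi ->
  (phi.1 (base1 y) * rad1 y + phi.2 (base2 y) * rad2 y)%:E <= H y.
Proof.
move=> [_ _ sub]; case: y => y1 y2.
have [x1 [r1 ->]] := coneP y1; have [x2 [r2 ->]] := coneP y2.
apply: le_trans (sub x1 x2 r1 r2).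
rewrite /rad1 /rad2 /base1 /base2 /= !cone_radiusE lee_fin.
have E (X : ptopologicalType) (f : X -> R) x (r : {nonneg R}) :
    (f (cone_base (cone_class x r)) * r%:num = f x * r%:num)%R.
  have [r0|r0] := eqVneq r%:num 0%R; first by rewrite r0 !mulr0.
  by rewrite cone_baseE// lt_def r0 /=.
by rewrite !E.
Qed.

(** The potentials may change sign.  A constant [M] is added to both, which
    reduces everything to integrals of nonnegative functions, and is cancelled at
    the end. *)
Lemma weak_duality phi : Phi_ H phi ->
  \int[mu1]_x (phi.1 x)%:E + \int[mu2]_x (phi.2 x)%:E <= \int[alpha]_y H y.
Proof.
move=> phiP; have [b1 b2 _] := phiP.
have [c1 [M1 M1P]] := b1; have [c2 [M2 M2P]] := b2.
have i1 := Cb_integrable mu1 b1; have i2 := Cb_integrable mu2 b2.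
pose M := Num.max `|M1|%R `|M2|%R.
have M0 : (0 <= M)%R by rewrite le_max normr_ge0.
have p1 x : (0 <= phi.1 x + M)%R.
  have := M1P x; rewrite ler_norml => /andP[h _].
  have : (M1 <= M)%R by rewrite le_max ler_norm.
  lra.
have p2 x : (0 <= phi.2 x + M)%R.
  have := M2P x; rewrite ler_norml => /andP[h _].
  have : (M2 <= M)%R by rewrite le_max (ler_norm M2) orbT.
  lra.
have cM1 : continuous (fun x => phi.1 x + M)%R.
  by move=> x; apply: cvgD; [exact: c1|exact: cvg_cst].
have cM2 : continuous (fun x => phi.2 x + M)%R.
  by move=> x; apply: cvgD; [exact: c2|exact: cvg_cst].
have [_ _ mu1E mu2E] := alphaP.
have r1 y : (0 <= @rad1 R X1 X2 y)%R by exact: cone_radius_ge0.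
have r2 y : (0 <= @rad2 R X1 X2 y)%R by exact: cone_radius_ge0.
have marginal1 := integral_radius_base (@rad1_continuous R X1 X2) r1
  (@base1_continuous R X1 X2) mu1E.
have marginal2 := integral_radius_base (@rad2_continuous R X1 X2) r2
  (@base2_continuous R X1 X2) mu2E.
have [mg1 g1] := marginal1 _ cM1 p1.
have [mg2 g2] := marginal2 _ cM2 p2.
have [mk1 k1] := marginal1 _ (fun x : X1 => @cvg_cst _ M _ (nbhs x) _) (fun=> M0).
have [mk2 k2] := marginal2 _ (fun x : X2 => @cvg_cst _ M _ (nbhs x) _) (fun=> M0).
have fin1 : mu1 setT \is a fin_num by exact: fin_num_measure.
have fin2 : mu2 setT \is a fin_num by exact: fin_num_measure.
have e1 : \int[mu1]_x (phi.1 x + M)%:E = \int[mu1]_x (phi.1 x)%:E + M%:E * mu1 setT.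
  under eq_integral do rewrite EFinD.
  rewrite integralD//=; last exact: finite_measure_integrable_cst.
  by rewrite integral_cst.
have e2 : \int[mu2]_x (phi.2 x + M)%:E = \int[mu2]_x (phi.2 x)%:E + M%:E * mu2 setT.
  under eq_integral do rewrite EFinD.
  rewrite integralD//=; last exact: finite_measure_integrable_cst.
  by rewrite integral_cst.
have main : \int[mu1]_x (phi.1 x + M)%:E + \int[mu2]_x (phi.2 x + M)%:E <=
    \int[alpha]_y H y + (M%:E * mu1 setT + M%:E * mu2 setT).
  have -> : M%:E * mu1 setT = \int[alpha]_y (M * rad1 y)%:E.
    by rewrite -k1 integral_cst.
  have -> : M%:E * mu2 setT = \int[alpha]_y (M * rad2 y)%:E.
    by rewrite -k2 integral_cst.
  rewrite g1 g2; apply: (integral_le_add2 alpha mg1 mg2 mk1 mk2 mH) => // y.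
  - by rewrite lee_fin mulr_ge0.
  - by rewrite lee_fin mulr_ge0.
  - by rewrite lee_fin mulr_ge0.
  - by rewrite lee_fin mulr_ge0.
  - rewrite -!EFinD.
    apply: le_trans (leeD2r (M * rad1 y + M * rad2 y)%:E (Phi_le y phiP)).
    by rewrite -EFinD lee_fin !mulrDl addrACA.
move: main; rewrite e1 e2.
have f1 : \int[mu1]_x (phi.1 x)%:E \is a fin_num by exact: integrable_fin_num.
have f2 : \int[mu2]_x (phi.2 x)%:E \is a fin_num by exact: integrable_fin_num.
rewrite addeACA leeD2rE// fin_numD !fin_numM//.
Qed.

End weak_duality.

Local Close Scope ereal_scope.

(** * Slices of the cost and sublinearity *)

Lemma truncation_continuous (R : realType) (T : topologicalType) (L : R)
    (f : T -> \bar R) x :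
  (forall y, 0 <= f y)%E -> 0 <= L -> f @ x --> f x ->
  (fun y => fine (Order.min (f y) L%:E)) @ x --> fine (Order.min (f x) L%:E).
Proof.
move=> f0 L0 cf; apply: fine_cvg; rewrite fineK; last first.
  rewrite ge0_fin_numE ?le_min ?f0 ?lee_fin//.
  by rewrite gt_min ltry orbT.
have cm := @min_continuous _ (\bar R) (f x, L%:E).
have cp : (fun y => (f y, L%:E)) @ x --> (f x, L%:E).
  by apply: continuous_pair => //; exact: cvg_cst.
exact: (@cvg_comp _ _ _ (fun y => (f y, L%:E))
  (fun z : \bar R * \bar R => Order.min z.1 z.2) _ _ _ cp cm).
Qed.

Section cost.
Variables (R : realType) (X1 X2 : ptopologicalType).
Local Notation C := (cone R X1 * cone R X2)%type.
Variable H : C -> \bar R.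

(** With [1 - t] and [t] as radii the slice never meets the product of the two
    apexes, the only point where [H] may be discontinuous. *)
Definition slice (x1 : X1) (x2 : X2) (t : R) : \bar R :=
  H (polar ((x1, x2), (1 - t, t))).

(** Truncation at a real level, as a real number. *)
Definition trunc_slice (L : R) (x1 : X1) (x2 : X2) (t : R) : R :=
  fine (Order.min (slice x1 x2 t) L%:E).

(** The value of [H] at the product of the apexes is [0] or [+oo] by
    homogeneity.  Counting it as [0] makes the relation below sublinear in the
    radii in both cases. *)
Definition cost_le (x : X1 * X2) (r1 r2 c : R) : Prop :=
  [/\ 0 <= r1, 0 <= r2, 0 <= c &
      (r1 = 0 /\ r2 = 0) \/ (H (polar (x, (r1, r2))) <= c%:E)%E].

Hypotheses (H_ge0 : forall y, (0 <= H y)%E)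
  (H_cont : forall y, y <> (apex, apex) -> {for y, continuous H})
  (H_hom : radially_homogeneous H) (H_conv : radially_convex H).

Lemma polar_hom x (l r1 r2 : R) : 0 < l -> 0 <= r1 -> 0 <= r2 ->
  H (polar (x, (l * r1, l * r2))) = (l%:E * H (polar (x, (r1, r2))))%E.
Proof.
move=> l0 r10 r20; have := H_hom (PosNum l0) x.1 x.2 `|r1|%:nng `|r2|%:nng.
move=> /= <-; congr H; congr pair; congr cone_class; apply/val_inj => /=;
  by rewrite normrM (gtr0_norm l0).
Qed.

Lemma cost_le0 x : cost_le x 0 0 0.
Proof. by split => //; left. Qed.

Lemma cost_leZ x l r1 r2 c : 0 <= l -> cost_le x r1 r2 c ->
  cost_le x (l * r1) (l * r2) (l * c).
Proof.
move=> l0 [r10 r20 c0 rc]; split; rewrite ?mulr_ge0//.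
have [->|ln0] := eqVneq l 0; first by left; rewrite !mul0r.
case: rc => [[-> ->]|Hc]; first by left; rewrite !mulr0.
have lpos : 0 < l by rewrite lt_def ln0.
by right; rewrite polar_hom// EFinM lee_pmul2l.
Qed.

(** Convexity at the midpoint and homogeneity give subadditivity. *)
Lemma cost_leD x r1 r2 c s1 s2 c' : cost_le x r1 r2 c -> cost_le x s1 s2 c' ->
  cost_le x (r1 + s1) (r2 + s2) (c + c').
Proof.
move=> [r10 r20 c0 rc] [s10 s20 c0' sc]; split; rewrite ?addr_ge0//.
case: rc => [[-> ->]|Hc]; case: sc => [[-> ->]|Hc'].
- by left; rewrite !addr0.
- by right; rewrite !add0r; apply: (le_trans Hc'); rewrite lee_fin lerDr.
- by right; rewrite !addr0; apply: (le_trans Hc); rewrite lee_fin lerDl.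
right.
have h0 : 0 <= 2^-1 :> R by rewrite invr_ge0.
have half : 2^-1 + 2^-1 = 1 :> R by lra.
pose nn (r : R) : {nonneg R} := NngNum (normr_ge0 r).
have nnE (u v : R) : polar (x, (u, v)) = (cone_class x.1 (nn u), cone_class x.2 (nn v)).
  by congr pair; congr cone_class; apply/val_inj.
have := @H_conv x.1 x.2 (nn r1) (nn r2) (nn s1) (nn s2) (NngNum h0) (NngNum h0) half.
rewrite -!nnE [X in (H X <= _)%E](_ : _ =
    polar (x, (2^-1 * (r1 + s1), 2^-1 * (r2 + s2)))%R); last first.
  congr pair; congr cone_class; apply/val_inj => /=;
  by rewrite mulrDr ger0_norm ?addr_ge0 ?mulr_ge0// !ger0_norm ?addr_ge0 ?mulr_ge0.
rewrite polar_hom ?invr_gt0 ?addr_ge0//= => le.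
rewrite -(@lee_pmul2l _ (2^-1)%:E) ?lte_fin ?invr_gt0//.
apply: (le_trans le); rewrite EFinD muleDr//; apply: leeD.
  by apply: lee_wpmul2l => //; rewrite lee_fin.
by apply: lee_wpmul2l => //; rewrite lee_fin.
Qed.

Lemma cost_le_mono x r1 r2 c c' : c <= c' -> cost_le x r1 r2 c ->
  cost_le x r1 r2 c'.
Proof.
move=> cc' [r10 r20 c0 rc]; split => //; first exact: le_trans cc'.
case: rc => [?|Hc]; [by left|right].
by apply: (le_trans Hc); rewrite lee_fin.
Qed.

Lemma cost_le_sum x (I : finType) (r1 r2 c : I -> R) :
  (forall i, cost_le x (r1 i) (r2 i) (c i)) ->
  cost_le x (\sum_i r1 i) (\sum_i r2 i) (\sum_i c i).
Proof.
move=> rc; apply: (big_ind3 (cost_le x)) => //; first exact: cost_le0.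
by move=> *; exact: cost_leD.
Qed.

Lemma cost_leP x r1 r2 c : 0 < r1 -> cost_le x r1 r2 c ->
  (H (polar (x, (r1, r2))) <= c%:E)%E.
Proof. by move=> r10 [_ _ _ [[r1E _]|//]]; rewrite r1E ltxx in r10. Qed.

Lemma slice_continuous :
  continuous (fun p : (X1 * X2) * R => slice p.1.1 p.1.2 p.2).
Proof.
move=> p.
have c : (fun p : (X1 * X2) * R => (p.1, (1 - p.2, p.2))) @ p
    --> (p.1, (1 - p.2, p.2)).
  apply: (@continuous_pair _ (X1 * X2)%type (R * R)%type fst
    (fun p : (X1 * X2) * R => (1 - p.2, p.2)) p).
    exact: cvg_fst.
  apply: (@continuous_pair _ R R (fun p : (X1 * X2) * R => 1 - p.2) snd p);
    last exact: cvg_snd.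
  by apply: cvgB; [exact: cvg_cst|exact: cvg_snd].
have E : (fun p : (X1 * X2) * R => slice p.1.1 p.1.2 p.2) =
    H \o (@polar R X1 X2 \o (fun p => (p.1, (1 - p.2, p.2)))).
  by apply/funext => -[[y1 y2] s].
have cp := @polar_continuous R X1 X2 (p.1, (1 - p.2, p.2)).
have c1 : (@polar R X1 X2 \o (fun p => (p.1, (1 - p.2, p.2)))) @ p -->
    polar (p.1, (1 - p.2, p.2)).
  exact: (cvg_comp _ _ c cp).
rewrite E; apply: (cvg_comp _ _ c1).
apply: H_cont; apply: polar_neq_apex => /=.
rewrite xpair_eqE negb_and; have [->|p0] := eqVneq p.2 0; last by rewrite orbT.
by rewrite subr0 oner_eq0.
Qed.

Variable L : R.
Hypothesis L0 : 0 <= L.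

Lemma trunc_slice_continuous :
  continuous (fun p : (X1 * X2) * R => trunc_slice L p.1.1 p.1.2 p.2).
Proof.
move=> p; apply: (truncation_continuous (fun _ => H_ge0 _) L0).
exact: slice_continuous.
Qed.

Lemma trunc_sliceE x1 x2 t :
  (trunc_slice L x1 x2 t)%:E = Order.min (slice x1 x2 t) L%:E.
Proof.
rewrite /trunc_slice fineK// ge0_fin_numE ?le_min ?H_ge0 ?lee_fin//.
by rewrite gt_min ltry orbT.
Qed.

Lemma trunc_slice_ge0 x1 x2 t : 0 <= trunc_slice L x1 x2 t.
Proof. by rewrite -lee_fin trunc_sliceE le_min H_ge0 lee_fin. Qed.

Lemma trunc_slice_le_slice x1 x2 t : ((trunc_slice L x1 x2 t)%:E <= slice x1 x2 t)%E.
Proof. by rewrite trunc_sliceE ge_min lexx. Qed.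

Lemma slice_le_trunc_slice x1 x2 t : trunc_slice L x1 x2 t < L ->
  (slice x1 x2 t <= (trunc_slice L x1 x2 t)%:E)%E.
Proof.
rewrite -lte_fin trunc_sliceE gt_min ltxx orbF => h.
by rewrite le_min lexx ltW.
Qed.

Lemma trunc_slice_cap x1 x2 t : (L%:E <= slice x1 x2 t)%E -> trunc_slice L x1 x2 t = L.
Proof. by move=> h; apply: EFin_inj; rewrite trunc_sliceE; apply/min_idPr. Qed.

Lemma cost_le_slice x t c : 0 <= t <= 1 -> (slice x.1 x.2 t <= c%:E)%E ->
  cost_le x (1 - t) t c.
Proof.
move=> /andP[t0 t1] hc; split; rewrite ?subr_ge0//.
  by rewrite -lee_fin; apply: le_trans hc; exact: H_ge0.
by right; move: hc; rewrite /slice -surjective_pairing.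
Qed.

End cost.

(** * The primal bound *)

Lemma compact_Cb (R : realType) (X : ptopologicalType) (f : X -> R) :
  compact [set: X] -> continuous f -> Cb R X f.
Proof.
move=> cX cf; split => //.
have [|//|M MP] := @compact_ereal_bounded R X (fun x => `|f x|%:E) cX.
- move=> x; apply: cvg_EFin; first exact: nearW.
  by apply: cvg_norm; exact: cf.
- by move=> x; rewrite ltry.
by exists M => x; have := MP x; rewrite lee_fin.
Qed.

Lemma integral_affine (R : realType) (X : ptopologicalType)
    (mu : {finite_measure set (borel X) -> \bar R}) (I : finType)
    (c : I -> R) (f : I -> X -> R) (d : R) :
  (forall i, Cb R X (f i)) ->
  (\int[mu]_x (\sum_i c i * f i x + d)%:E =
   (\sum_i c i * fine (\int[mu]_x (f i x)%:E) + d * fine (mu setT))%:E)%E.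
Proof.
move=> cf.
have fi i : mu.-integrable setT (EFin \o f i : borel X -> \bar R).
  exact: Cb_integrable.
have cfi i : mu.-integrable setT (fun x : borel X => (c i * f i x)%:E).
  exact: (@integrableZl _ _ _ mu setT measurableT (c i) _ (fi i)).
have si : mu.-integrable setT (fun x : borel X => (\sum_i c i * f i x)%:E).
  rewrite (_ : (fun x => _) = (fun x => \sum_i (c i * f i x)%:E)%E).
    exact: integrable_sum.
  by apply/funext => x; rewrite sumEFin.
have di : mu.-integrable setT (fun x : borel X => d%:E).
  exact: finite_measure_integrable_cst.
under eq_integral do rewrite EFinD.
rewrite (integralD _ si di)//.
rewrite integral_cst// EFinD EFinM fineK ?fin_num_measure//; congr (_ + _)%E.
under eq_integral do rewrite -sumEFin.
rewrite integral_sum//= -sumEFin; apply: eq_bigr => i _.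
rewrite EFinM fineK; last first.
  exact: (integrable_fin_num measurableT (fi i)).
exact: (integralZl measurableT (fi i) (c i)).
Qed.

(** The direction [(F / M2, G / M1)] is so close to [(1 - t0, t0)] that it lies
    in the cone spanned by the two directions [t0 - delta] and [t0 + delta], where
    the cost is at most [C]. *)
Lemma fill_cost (R : realType) (X1 X2 : ptopologicalType)
    (H : cone R X1 * cone R X2 -> \bar R) (x : X1 * X2)
    (M1 M2 t0 delta C theta F G : R) :
  (forall y, (0 <= H y)%E) -> radially_homogeneous H -> radially_convex H ->
  0 < M1 -> 0 < M2 -> t0 * (M1 + M2) = M2 ->
  0 < delta -> 0 <= t0 - delta -> t0 + delta <= 1 ->
  (slice H x.1 x.2 (t0 - delta) <= C%:E)%E ->
  (slice H x.1 x.2 (t0 + delta) <= C%:E)%E ->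
  0 < theta -> `|F - theta| <= delta * theta / 2 ->
  `|G - theta| <= delta * theta / 2 ->
  cost_le H x (F / M2) (G / M1) (2 * theta * (M1^-1 + M2^-1) * C).
Proof.
move=> H0 Hh Hc M10 M20 t0E d0 dlo dhi Clo Chi th0 FT GT.
have M12 : 0 < M1 + M2 by rewrite addr_gt0.
have iM1 : 0 < M1^-1 by rewrite invr_gt0.
have iM2 : 0 < M2^-1 by rewrite invr_gt0.
have cost_lo : cost_le H x (1 - (t0 - delta)) (t0 - delta) C.
  by apply: cost_le_slice => //; lra.
have cost_hi : cost_le H x (1 - (t0 + delta)) (t0 + delta) C.
  by apply: cost_le_slice => //; lra.
have C0 : 0 <= C by have [_ _ ? _] := cost_lo.
set r1 := F / M2; set r2 := G / M1.
(* The coefficients on the two directions are [(r1 + r2 - D) / 2] and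
   [(r1 + r2 + D) / 2]. *)
pose D := (r2 - (r1 + r2) * t0) / delta.
have dth : delta * theta <= theta / 2 by rewrite -subr_ge0; nra.
move: FT GT; rewrite !ler_norml => /andP[F1 F2] /andP[G1 G2].
have DE : r2 - (r1 + r2) * t0 = (G - F) / (M1 + M2).
  have -> : t0 = M2 / (M1 + M2) := canRL (mulfK (lt0r_neq0 M12)) t0E.
  by rewrite /r1 /r2; field; rewrite !gt_eqF.
have sumlo : theta / 2 * (M1^-1 + M2^-1) <= r1 + r2.
  rewrite /r1 /r2 mulrDr [leRHS]addrC; apply: lerD; rewrite ler_pM2r//; lra.
have sumhi : r1 + r2 <= 2 * theta * (M1^-1 + M2^-1).
  rewrite /r1 /r2 mulrDr [leLHS]addrC; apply: lerD; rewrite ler_pM2r//; lra.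
have key : (M1 + M2)^-1 * 2 <= M1^-1 + M2^-1.
  have -> : M1^-1 + M2^-1 = (M1 + M2) / (M1 * M2) by field; rewrite !gt_eqF.
  rewrite mulrC ler_pdivrMr// mulrAC ler_pdivlMr ?mulr_gt0//; nra.
have Dle : `|D| <= r1 + r2.
  rewrite /D DE normrM normfV (gtr0_norm d0) ler_pdivrMr// normrM normfV.
  rewrite (gtr0_norm M12).
  have GF : `|G - F| <= delta * theta by rewrite ler_norml; apply/andP; split; lra.
  apply: (@le_trans _ _ (delta * theta * (M1 + M2)^-1)).
    by rewrite ler_pM2r ?invr_gt0.
  apply: (@le_trans _ _ ((theta / 2 * (M1^-1 + M2^-1)) * delta)); last first.
    by rewrite ler_pM2r.
  have -> : delta * theta * (M1 + M2)^-1 = theta / 2 * ((M1 + M2)^-1 * 2) * delta.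
    by field; rewrite gt_eqF.
  by rewrite ler_pM2r// ler_pM2l// divr_gt0.
move: Dle; rewrite ler_norml => /andP[D1 D2].
have p0 : 0 <= (r1 + r2 - D) / 2 by lra.
have q0 : 0 <= (r1 + r2 + D) / 2 by lra.
have := cost_leD Hh Hc (cost_leZ Hh p0 cost_lo) (cost_leZ Hh q0 cost_hi).
have Dd : D * delta = r2 - (r1 + r2) * t0 by rewrite /D divfK// gt_eqF.
rewrite (_ : _ * (1 - (t0 - delta)) + _ = r1); last by nra.
rewrite (_ : _ * (t0 - delta) + _ = r2); last by nra.
apply: cost_le_mono.
rewrite -mulrDl; have -> : (r1 + r2 - D) / 2 + (r1 + r2 + D) / 2 = r1 + r2 by lra.
by rewrite ler_wpM2r.
Qed.

Lemma sum_fiber (R : realType) (I K : finType) (pi : K -> I) (f : I -> R)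
    (g : K -> R) :
  \sum_p f (pi p) * g p = \sum_i f i * \sum_p (pi p == i)%:R * g p.
Proof.
under [RHS]eq_bigr do rewrite mulr_sumr.
rewrite exchange_big/=; apply: eq_bigr => p _.
rewrite (eq_bigr (fun i => (pi p == i)%:R * (f i * g p))); last first.
  by move=> i _; ring.
by rewrite sum_delta.
Qed.

Lemma average_close (R : realType) (I : finType) (chi f : I -> R) (c e : R) :
  (forall i, 0 <= chi i) -> \sum_i chi i = 1 -> (forall i, `|f i - c| <= e) ->
  `|\sum_i chi i * f i - c| <= e.
Proof.
move=> chi0 chi1 fc.
have -> : \sum_i chi i * f i - c = \sum_i chi i * (f i - c).
  by under [RHS]eq_bigr do rewrite mulrBr; rewrite sumrB -mulr_suml chi1 mul1r.
apply: (le_trans (ler_norm_sum _ _ _)).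
rewrite -[leRHS]mul1r -chi1 mulr_suml; apply: ler_sum => i _.
by rewrite normrM ger0_norm// ler_wpM2l.
Qed.

(** The densities are [1 - theta] times those given by the weights [w], plus
    [F x1 / M2] and [G x2 / M1], where [F] and [G] interpolate the missing row and
    column masses.  These are close to [theta] since the residuals are at most
    [delta * theta / 2], so that the correction is positive and, by [fill_cost], has
    a cost of order [theta].  Positivity also keeps the coupling away from the
    product of the apexes. *)
Lemma primal_bound (R : realType) (X1 X2 : ptopologicalType)
    (H : cone R X1 * cone R X2 -> \bar R)
    (mu1 : {finite_measure set (borel X1) -> \bar R})
    (mu2 : {finite_measure set (borel X2) -> \bar R})
    (I J K : finType) (chi : I -> X1 -> R) (psi : J -> X2 -> R)
    (pi : K -> I) (pj : K -> J) (t w k : K -> R) (t0 delta C theta : R) :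
  compact [set: X1] -> metrizable R X1 -> compact [set: X2] -> metrizable R X2 ->
  (forall y, (0 <= H y)%E) ->
  (forall y, y <> (apex, apex) -> {for y, continuous H}) ->
  radially_homogeneous H -> radially_convex H ->
  radon X1 mu1 -> radon X2 mu2 ->
  let M1 := fine (mu1 setT) in let M2 := fine (mu2 setT) in
  let m i := fine (\int[mu1]_x (chi i x)%:E)%E in
  let n j := fine (\int[mu2]_x (psi j x)%:E)%E in
  0 < M1 -> 0 < M2 -> t0 * (M1 + M2) = M2 ->
  0 < delta -> 0 <= t0 - delta -> t0 + delta <= 1 ->
  (forall x1 x2, (slice H x1 x2 (t0 - delta) <= C%:E)%E) ->
  (forall x1 x2, (slice H x1 x2 (t0 + delta) <= C%:E)%E) ->
  0 < theta -> theta <= 1 ->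
  (forall i, continuous (chi i)) -> (forall i x, 0 <= chi i x) ->
  (forall x, \sum_i chi i x = 1) ->
  (forall j, continuous (psi j)) -> (forall j x, 0 <= psi j x) ->
  (forall x, \sum_j psi j x = 1) ->
  (forall p, 0 <= t p <= 1) -> (forall p, 0 <= w p) -> (forall p, 0 <= k p) ->
  (forall i, `|\sum_p (pi p == i)%:R * (n (pj p) * (1 - t p)) * w p - 1|
    <= delta * theta / 2) ->
  (forall j, `|\sum_p (pj p == j)%:R * (m (pi p) * t p) * w p - 1|
    <= delta * theta / 2) ->
  (forall p x1 x2, 0 < w p -> chi (pi p) x1 != 0 -> psi (pj p) x2 != 0 ->
    (slice H x1 x2 (t p) <= (k p)%:E)%E) ->
  (unbalanced_cost H mu1 mu2 <=
   (\sum_p m (pi p) * n (pj p) * k p * w p + 2 * theta * (M1 + M2) * C)%:E)%E.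
Proof.
move=> cX1 mX1 cX2 mX2 H0 Hcont Hh Hc rmu1 rmu2 M1 M2 m n M10 M20 t0E d0 dlo dhi.
move=> Clo Chi th0 th1 cchi chi0 chi1 cpsi psi0 psi1 t01 w0 k0 rowP colP sliceP.
pose A i := \sum_p (pi p == i)%:R * (n (pj p) * (1 - t p)) * w p.
pose B j := \sum_p (pj p == j)%:R * (m (pi p) * t p) * w p.
pose f i := 1 - (1 - theta) * A i.
pose g j := 1 - (1 - theta) * B j.
have near1 (r e : R) : `|r - 1| <= e -> `|1 - (1 - theta) * r - theta| <= e.
  move=> re; have -> : 1 - (1 - theta) * r - theta = (1 - theta) * (1 - r) by ring.
  rewrite normrM ger0_norm ?subr_ge0// distrC.
  apply: le_trans re; rewrite ler_piMl//; lra.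
pose F (x : X1) := \sum_i chi i x * f i.
pose G (x : X2) := \sum_j psi j x * g j.
have FT x : `|F x - theta| <= delta * theta / 2.
  by apply: average_close => // i; apply: near1; exact: rowP.
have GT x : `|G x - theta| <= delta * theta / 2.
  by apply: average_close => // j; apply: near1; exact: colP.
have dth : delta * theta <= theta by rewrite ler_piMl ?ltW//; lra.
have F0 x : 0 < F x by have := FT x; rewrite ler_norml => /andP[]; lra.
have G0 x : 0 < G x by have := GT x; rewrite ler_norml => /andP[]; lra.
pose cp p (x : X1 * X2) := chi (pi p) x.1 * psi (pj p) x.2 * w p.
have cp0 p x : 0 <= cp p x by rewrite /cp !mulr_ge0.
pose a (x : X1 * X2) := (1 - theta) * (\sum_p cp p x * (1 - t p)) + F x.1 / M2.
pose b (x : X1 * X2) := (1 - theta) * (\sum_p cp p x * t p) + G x.2 / M1.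
pose D := 2 * theta * (M1^-1 + M2^-1) * C.
pose E (x : X1 * X2) := (1 - theta) * (\sum_p cp p x * k p) + D.
have ccp p : continuous (cp p).
  move=> x; apply: cvgM; last exact: cvg_cst.
  apply: cvgM.
    by apply: (@continuous_comp _ _ _ fst); [exact: cvg_fst|exact: cchi].
  by apply: (@continuous_comp _ _ _ snd); [exact: cvg_snd|exact: cpsi].
have ccs (c : K -> R) : continuous (fun x => (1 - theta) * \sum_p cp p x * c p).
  move=> x; apply: cvgM; first exact: cvg_cst.
  apply: continuous_sumr => p _ y; apply: cvgM; last exact: cvg_cst.
  exact: ccp.
have cF : continuous F.
  apply: continuous_sumr => i _ y; apply: cvgM; last exact: cvg_cst.
  exact: cchi.
have cG : continuous G.
  apply: continuous_sumr => j _ y; apply: cvgM; last exact: cvg_cst.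
  exact: cpsi.
have ca : continuous a.
  move=> x; apply: cvgD; first exact: ccs.
  apply: cvgM; last exact: cvg_cst.
  by apply: (@continuous_comp _ _ _ fst); [exact: cvg_fst|exact: cF].
have cb : continuous b.
  move=> x; apply: cvgD; first exact: ccs.
  apply: cvgM; last exact: cvg_cst.
  by apply: (@continuous_comp _ _ _ snd); [exact: cvg_snd|exact: cG].
have cE : continuous E by move=> x; apply: cvgD; [exact: ccs|exact: cvg_cst].
have th1' : 0 <= 1 - theta by rewrite subr_ge0.
have a0 x : 0 < a x.
  rewrite /a ltr_wpDl ?divr_gt0// mulr_ge0// sumr_ge0// => p _.
  by rewrite mulr_ge0//; have := t01 p; lra.
have b0 x : 0 < b x.
  rewrite /b ltr_wpDl ?divr_gt0// mulr_ge0// sumr_ge0// => p _.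
  by rewrite mulr_ge0//; have := t01 p; lra.
have Cchi i : Cb R X1 (chi i) by exact: compact_Cb.
have Cpsi j : Cb R X2 (psi j) by exact: compact_Cb.
have a1 x : (\int[mu2]_y (a (x, y))%:E = 1)%E.
  under eq_integral => y _.
    rewrite (_ : a (x, y) = \sum_p ((1 - theta) * (chi (pi p) x * w p * (1 - t p)))
      * psi (pj p) y + F x / M2); last first.
      rewrite /a mulr_sumr; congr (_ + _); apply: eq_bigr => p _.
      by rewrite /cp /=; ring.
    over.
  rewrite integral_affine// -/M2 divfK ?gt_eqF//.
  rewrite (eq_bigr (fun p => (1 - theta) * (chi (pi p) x *
    ((n (pj p) * (1 - t p)) * w p)))); last by move=> p _; rewrite /n; ring.
  rewrite -mulr_sumr (sum_fiber pi (chi ^~ x)) mulr_sumr -big_split/=.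
  rewrite (eq_bigr (chi ^~ x)) ?chi1// => i _.
  rewrite /f /A; under eq_bigr do rewrite mulrA.
  ring.
have b1 y : (\int[mu1]_x (b (x, y))%:E = 1)%E.
  under eq_integral => x _.
    rewrite (_ : b (x, y) = \sum_p ((1 - theta) * (psi (pj p) y * w p * t p))
      * chi (pi p) x + G y / M1); last first.
      rewrite /b mulr_sumr; congr (_ + _); apply: eq_bigr => p _.
      by rewrite /cp /=; ring.
    over.
  rewrite integral_affine// -/M1 divfK ?gt_eqF//.
  rewrite (eq_bigr (fun p => (1 - theta) * (psi (pj p) y *
    ((m (pi p) * t p) * w p)))); last by move=> p _; rewrite /m; ring.
  rewrite -mulr_sumr (sum_fiber pj (psi ^~ y)) mulr_sumr -big_split/=.
  rewrite (eq_bigr (psi ^~ y)) ?psi1// => j _.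
  rewrite /g /B; under eq_bigr do rewrite mulrA.
  ring.
have HE x : (H (polar (x, (a x, b x))) <= (E x)%:E)%E.
  apply: cost_leP (a0 x) _; apply: cost_leD => //; last first.
    by apply: (@fill_cost R X1 X2 H _ M1 M2 t0 delta).
  apply: cost_leZ => //.
  apply: cost_le_sum => // p.
  (* The cost is only known where the weight and both bumps are nonzero. *)
  have [c0|cn0] := eqVneq (cp p x) 0; first by rewrite c0 !mul0r; exact: cost_le0.
  apply: cost_leZ => //; apply: cost_le_slice => //; move: cn0; rewrite /cp.
  rewrite !mulf_eq0 !negb_or => /andP[/andP[? ?] wn0].
  by apply: sliceP => //; rewrite lt_def wn0 w0.
have mH := cost_measurable Hcont.
have [alpha alphaP alphaE] :=
  continuous_coupling cX1 mX1 cX2 mX2 rmu1 rmu2 ca cb a0 b0 a1 b1.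
apply: (@le_trans _ _ (\int[alpha]_y H y)%E).
  by apply: ereal_inf_lbound; exists alpha.
apply: (le_trans (alphaE H E H0 mH cE HE)).
have C0 : 0 <= C.
  by rewrite -lee_fin; apply: le_trans (Clo point point); exact: H0.
have D0 : 0 <= D.
  rewrite /D; apply: mulr_ge0 => //; apply: mulr_ge0; first by rewrite mulr_ge0// ltW.
  by rewrite addr_ge0// invr_ge0 ltW.
have E0 x : 0 <= E x.
  by rewrite /E addr_ge0// mulr_ge0// sumr_ge0// => p _; rewrite mulr_ge0.
rewrite fubini_tonelli1; last 2 first.
- by apply/measurable_EFinP; exact: (prod_real_measurable_fun cX2 mX2).
- by move=> x; rewrite lee_fin.
rewrite /fubini_F.
have inner x : (\int[mu2]_y (E (x, y))%:E =
    (\sum_p ((1 - theta) * (w p * k p * n (pj p))) * chi (pi p) x + D * M2)%:E)%E.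
  under eq_integral => y _.
    rewrite (_ : E (x, y) = \sum_p ((1 - theta) * (chi (pi p) x * w p * k p))
      * psi (pj p) y + D); last first.
      rewrite /E mulr_sumr; congr (_ + _); apply: eq_bigr => p _.
      by rewrite /cp /=; ring.
    over.
  rewrite integral_affine//; congr ((_ + _)%:E); apply: eq_bigr => p _.
  by rewrite /n; ring.
under eq_integral do rewrite inner.
rewrite integral_affine// lee_fin -/M1; apply: lerD.
  apply: ler_sum => p _.
  have mn0 : 0 <= m (pi p) * n (pj p) * k p * w p.
    rewrite !mulr_ge0//; apply: fine_ge0; apply: integral_ge0 => x _;
      by rewrite lee_fin.
  rewrite -/(m (pi p)); rewrite -subr_ge0.
  have -> : m (pi p) * n (pj p) * k p * w p -
    (1 - theta) * (w p * k p * n (pj p)) * m (pi p) =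
    theta * (m (pi p) * n (pj p) * k p * w p) by ring.
  by rewrite mulr_ge0// ltW.
rewrite /D.
have -> : 2 * theta * (M1^-1 + M2^-1) * C * M2 * M1 = 2 * theta * (M1 + M2) * C.
  by field; rewrite !gt_eqF.
by [].
Qed.

(** * Near-optimal potentials *)

(** A weighted average only sees the indices with a nonzero weight. *)
Lemma average_le (R : realType) (I : finType) (chi g : I -> R) (D : R) :
  (forall i, 0 <= chi i) -> \sum_i chi i = 1 ->
  (forall i, chi i != 0 -> g i <= D) -> \sum_i chi i * g i <= D.
Proof.
move=> chi0 chi1 gD; rewrite -[leRHS]mul1r -chi1 mulr_suml.
apply: ler_sum => i _; have [->|c0] := eqVneq (chi i) 0; first by rewrite !mul0r.
by rewrite ler_wpM2l// gD.
Qed.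

Lemma integral_le_add (R : realType) (X : ptopologicalType)
    (mu : {finite_measure set (borel X) -> \bar R}) (f g : X -> R) (e : R) :
  Cb R X f -> Cb R X g -> (forall x, f x <= g x + e) ->
  fine (\int[mu]_x (f x)%:E)%E <= fine (\int[mu]_x (g x)%:E)%E + e * fine (mu setT).
Proof.
move=> cf cg fg.
have gE := @integral_affine R X mu unit (fun=> 1) (fun=> g) e (fun=> cg).
have ife := Cb_integrable mu cf; have ige := Cb_integrable mu cg.
have ice : mu.-integrable setT (fun x : borel X => e%:E).
  exact: finite_measure_integrable_cst.
have gE' : (\int[mu]_x (g x + e)%:E =
    (fine (\int[mu]_x (g x)%:E) + e * fine (mu setT))%:E)%E.
  move: gE; rewrite big_const card_unit /= addr0 mul1r => <-.
  by apply: eq_integral => x _; rewrite big_const card_unit /= addr0 mul1r.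
rewrite -lee_fin -gE' fineK; last exact: (integrable_fin_num measurableT ife).
apply: le_integral => //; last by move=> x _; rewrite lee_fin.
exact: (integrableD measurableT ige ice).
Qed.

Lemma integral_gt0 (R : realType) (X : ptopologicalType)
    (mu : {finite_measure set (borel X) -> \bar R}) (f : X -> R) (x : X) :
  msupport X mu = setT -> Cb R X f -> (forall y, 0 <= f y) -> 0 < f x ->
  0 < fine (\int[mu]_y (f y)%:E)%E.
Proof.
move=> supp cf f0 fx; have [ccf _] := cf; have ife := Cb_integrable mu cf.
pose O := [set y | f x / 2 < f y].
have oO : open O.
  rewrite (_ : O = f @^-1` [set r | f x / 2 < r])//.
  by apply: open_comp; [move=> y _; exact: ccf|exact: open_gt].
have muO : (0 < mu O)%E.
  have : msupport X mu x by rewrite supp.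
  by apply => //; rewrite /O /=; lra.
have mO : measurable (O : set (borel X)) by exact: open_borel.
apply: fine_gt0; apply/andP; split; last first.
  by rewrite ltey_eq (integrable_fin_num measurableT ife).
apply: (@lt_le_trans _ _ ((f x / 2)%:E * mu O)%E).
  by rewrite mule_gt0// lte_fin; lra.
rewrite -integral_cst//.
apply: (@le_trans _ _ (\int[mu]_(y in O) (f y)%:E)%E).
  apply: ge0_le_integral => //.
  - by move=> y _; rewrite lee_fin; lra.
  - by apply/measurable_funTS; exact: (measurable_int _ ife).
  - by move=> y Oy; rewrite lee_fin ltW.
apply: ge0_subset_integral => //; first exact: (measurable_int _ ife).
by move=> y _; rewrite lee_fin.
Qed.

Lemma near_close_cost (R : realType) (X Y : topologicalType)
    (k : X -> Y -> R -> R) (e : R) (x : X) :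
  compact [set: Y] -> continuous (fun p : (X * Y) * R => k p.1.1 p.1.2 p.2) ->
  0 < e -> \forall x' \near x, close_cost k e x x'.
Proof.
move=> cY ck e0; pose Kc : set (Y * R) := [set: Y] `*` `[0, 1]%classic.
have cK : compact Kc by apply: compact_setX => //; exact: segment_compact.
have cs : continuous (fun z : (Y * R) * X => k z.2 z.1.1 z.1.2).
  move=> z.
  have c1 : (fun z : (Y * R) * X => ((z.2, z.1.1), z.1.2)) @ z -->
      ((z.2, z.1.1), z.1.2).
    apply: (@continuous_pair _ (X * Y)%type R
      (fun z : (Y * R) * X => (z.2, z.1.1)) (fun z => z.1.2) z).
      apply: (@continuous_pair _ X Y snd (fun z : (Y * R) * X => z.1.1) z).
        exact: cvg_snd.
      by apply: (@continuous_comp _ _ _ fst fst); exact: cvg_fst.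
    by apply: (@continuous_comp _ _ _ fst snd); [exact: cvg_fst|exact: cvg_snd].
  exact: (cvg_comp _ _ c1 (ck ((z.2, z.1.1), z.1.2))).
have := @tube_oscillation R X (Y * R)%type Kc x (fun a b => k a b.1 b.2) e cK.
move=> /(_ cs e0); apply: filterS => y h x2 t t01.
by apply: (h (x2, t)); split => //=; rewrite in_itv.
Qed.

Section near_truncated.
Variables (R : realType) (X1 X2 : ptopologicalType)
  (H : cone R X1 * cone R X2 -> \bar R).
Hypotheses (cX1 : compact [set: X1]) (cX2 : compact [set: X2])
  (H_ge0 : forall y, (0 <= H y)%E)
  (H_cont : forall y, y <> (apex, apex) -> {for y, continuous H}).
Variables (L : R) (L0 : 0 <= L).

Lemma near_close1 (e : R) (x : X1) : 0 < e ->
  \forall y \near x, close_cost (trunc_slice H L) e x y.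
Proof. exact: (near_close_cost x cX2 (trunc_slice_continuous H_ge0 H_cont L0)). Qed.

(** The exchange of the two factors turns [t] into [1 - t]. *)
Lemma near_close2 (e : R) (x : X2) : 0 < e ->
  \forall y \near x,
    close_cost (fun x2 x1 t => trunc_slice H L x1 x2 (1 - t)) e x y.
Proof.
apply: near_close_cost => // z.
have c1 : (fun z : (X2 * X1) * R => ((z.1.2, z.1.1), 1 - z.2)) @ z -->
    ((z.1.2, z.1.1), 1 - z.2).
  apply: (@continuous_pair _ (X1 * X2)%type R
    (fun z : (X2 * X1) * R => (z.1.2, z.1.1)) (fun z => 1 - z.2) z).
    apply: (@continuous_pair _ X1 X2 (fun z : (X2 * X1) * R => z.1.2)
      (fun z => z.1.1) z).
      by apply: (@continuous_comp _ _ _ fst snd); [exact: cvg_fst|exact: cvg_snd].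
    by apply: (@continuous_comp _ _ _ fst fst); exact: cvg_fst.
  by apply: cvgB; [exact: cvg_cst|exact: cvg_snd].
have ct := @trunc_slice_continuous R X1 X2 H H_ge0 H_cont L L0
  ((z.1.2, z.1.1), 1 - z.2).
exact: (cvg_comp _ _ c1 ct).
Qed.

End near_truncated.

(** The discrete solution is read in two ways: the multipliers, spread by the
    partitions of unity and lowered by [4 * eps], are feasible potentials, and the
    weights bound the primal value by [primal_bound].  Complementary slackness shows
    that the weights only charge triples where the truncated cost is at most [S],
    hence where truncation at [L] is not felt even after a small displacement. *)
Lemma near_optimal (R : realType) (X1 X2 : ptopologicalType)
    (H : cone R X1 * cone R X2 -> \bar R)
    (mu1 : {finite_measure set (borel X1) -> \bar R})
    (mu2 : {finite_measure set (borel X2) -> \bar R}) (t0 delta C L eps : R) :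
  compact [set: X1] -> metrizable R X1 -> compact [set: X2] -> metrizable R X2 ->
  (forall y, (0 <= H y)%E) ->
  (forall y, y <> (apex, apex) -> {for y, continuous H}) ->
  radially_homogeneous H -> radially_convex H ->
  radon X1 mu1 -> radon X2 mu2 ->
  msupport X1 mu1 = setT -> msupport X2 mu2 = setT ->
  let M1 := fine (mu1 setT) in let M2 := fine (mu2 setT) in
  let S := (C + 2) * (1 + delta^-1) in
  0 < M1 -> 0 < M2 -> t0 * (M1 + M2) = M2 ->
  0 < delta -> 0 <= t0 - delta -> t0 + delta <= 1 ->
  (forall x1 x2, (slice H x1 x2 (t0 - delta) <= C%:E)%E) ->
  (forall x1 x2, (slice H x1 x2 (t0 + delta) <= C%:E)%E) ->
  0 <= L -> S + 3 <= L -> 0 < eps -> eps <= 1 ->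
  exists phi1 phi2, [/\ continuous phi1 /\ continuous phi2,
    (forall x, phi1 x <= S) /\ (forall x, phi2 x <= S),
    dual_feasible (trunc_slice H L) phi1 phi2 &
    (unbalanced_cost H mu1 mu2 <= (fine (\int[mu1]_x (phi1 x)%:E) +
      fine (\int[mu2]_x (phi2 x)%:E) + (M1 + M2) * (6 + C) * eps)%:E)%E].
Proof.
move=> cX1 mX1 cX2 mX2 H0 Hcont Hh Hc rmu1 rmu2 supp1 supp2 M1 M2 S M10 M20 t0E.
move=> d0 dlo dhi Clo Chi L0 SL e0 e1.
have [I [c1 [chi [cchi chi0 chi1 chiP chi_c]]]] :=
  partition_of_unity cX1 mX1 (fun x => near_close1 cX2 H0 Hcont L0 x e0).
have [J [c2 [psi [cpsi psi0 psi1 psiP psi_c]]]] :=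
  partition_of_unity cX2 mX2 (fun x => near_close2 cX1 H0 Hcont L0 x e0).
have Cchi i : Cb R X1 (chi i) by exact: compact_Cb.
have Cpsi j : Cb R X2 (psi j) by exact: compact_Cb.
pose m i := fine (\int[mu1]_x (chi i x)%:E)%E.
pose n j := fine (\int[mu2]_x (psi j x)%:E)%E.
have m0 i : 0 < m i by exact: (integral_gt0 supp1 (Cchi i) (chi0 i) (chi_c i)).
have n0 j : 0 < n j by exact: (integral_gt0 supp2 (Cpsi j) (psi0 j) (psi_c j)).
have mM : \sum_i m i = M1.
  have := integral_affine mu1 (fun=> 1) 0 Cchi.
  rewrite mul0r addr0; under eq_integral => x _.
    rewrite (_ : (_ + 0) = 1); last first.
      by under eq_bigr do rewrite mul1r; rewrite chi1 addr0.
    over.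
  rewrite integral_cst// mul1e => h; apply/esym; apply: etrans (congr1 fine h) _.
  by apply: eq_bigr => i _; rewrite mul1r.
have nM : \sum_j n j = M2.
  have := integral_affine mu2 (fun=> 1) 0 Cpsi.
  rewrite mul0r addr0; under eq_integral => x _.
    rewrite (_ : (_ + 0) = 1); last first.
      by under eq_bigr do rewrite mul1r; rewrite psi1 addr0.
    over.
  rewrite integral_cst// mul1e => h; apply/esym; apply: etrans (congr1 fine h) _.
  by apply: eq_bigr => i _; rewrite mul1r.
have cX12 : compact [set: X1 * X2] by rewrite -setXTT; exact: compact_setX.
have [N N0 osc] := uniform_osc cX12 (trunc_slice_continuous H0 Hcont L0) e0.
pose k i j t := trunc_slice H L (c1 i) (c2 j) t.
have k0 i j t : 0 <= k i j t by exact: trunc_slice_ge0.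
pose theta := eps / 2.
have th0 : 0 < theta by rewrite /theta; lra.
have th1 : theta <= 1 by rewrite /theta; lra.
have eta0 : 0 < delta * theta / 2 by rewrite divr_gt0// mulr_gt0.
have trunc_sliceC x1 x2 t : (slice H x1 x2 t <= C%:E)%E -> trunc_slice H L x1 x2 t <= C.
  by move=> h; rewrite -lee_fin; apply: le_trans h; exact: trunc_slice_le_slice.
have [w [u [v [w0 feas [uS vS] [rowP colP] [wS cost_dual]]]]] :=
  @discrete_duality R I J m n M1 M2 N k eps C t0 delta (delta * theta / 2)
    m0 n0 mM nM M10 M20 N0 e0 e1 (fun i j t _ => k0 i j t)
    (fun i j => osc (c1 i, c2 j)) t0E d0 dlo dhi
    (fun i j => trunc_sliceC _ _ _ (Clo _ _))
    (fun i j => trunc_sliceC _ _ _ (Chi _ _)) eta0.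
have t01 (p : I * J * 'I_N.+1) : 0 <= (p.2%:R / N%:R : R) <= 1.
  by rewrite divr_ge0//= ler_pdivrMr ?ltr0n// mul1r ler_nat -ltnS.
have closeP i j x1 x2 t : 0 <= t <= 1 -> chi i x1 != 0 -> psi j x2 != 0 ->
    `|k i j t - trunc_slice H L x1 x2 t| <= 2 * eps.
  move=> t01' ci cj; have h1 := chiP i x1 ci (c2 j) t t01'.
  have h2 : `|trunc_slice H L x1 (c2 j) t - trunc_slice H L x1 x2 t| <= eps.
    have := psiP j x2 cj x1 (1 - t); rewrite subKr; apply; lra.
  have -> : k i j t - trunc_slice H L x1 x2 t = (k i j t - trunc_slice H L x1 (c2 j) t) +
     (trunc_slice H L x1 (c2 j) t - trunc_slice H L x1 x2 t) by ring.
  by apply: (le_trans (ler_normD _ _)); rewrite /k; lra.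
have C0 : 0 <= C.
  by rewrite -lee_fin; apply: le_trans (Clo point point); exact: H0.
have primal := @primal_bound R X1 X2 H mu1 mu2 I J _ chi psi
  (fun p : I * J * 'I_N.+1 => p.1.1) (fun p => p.1.2) (fun p => p.2%:R / N%:R) w
  (fun p => k p.1.1 p.1.2 (p.2%:R / N%:R) + 2 * eps) t0 delta C theta
  cX1 mX1 cX2 mX2 H0 Hcont Hh Hc rmu1 rmu2 M10 M20 t0E d0 dlo dhi Clo Chi th0 th1
  cchi chi0 chi1 cpsi psi0 psi1 t01 w0.
have {}primal : (unbalanced_cost H mu1 mu2 <= (\sum_(p : I * J * 'I_N.+1)
    m p.1.1 * n p.1.2 * (k p.1.1 p.1.2 (p.2%:R / N%:R) + 2 * eps) * w p +
    2 * theta * (M1 + M2) * C)%:E)%E.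
  apply: primal => // [p|p x1 x2 wp ci cj].
    by have := k0 p.1.1 p.1.2 (p.2%:R / N%:R); lra.
  have := closeP _ _ _ _ _ (t01 p) ci cj; rewrite ler_norml => /andP[h1 h2].
  have h3 := wS p wp.
  apply: (@le_trans _ _ (trunc_slice H L x1 x2 (p.2%:R / N%:R))%:E).
    apply: slice_le_trunc_slice => //; rewrite -/S in h3; lra.
  by rewrite lee_fin; lra.
have mass : \sum_(p : I * J * 'I_N.+1) m p.1.1 * n p.1.2 * w p <= 2 * (M1 + M2).
  have eta1 : delta * theta / 2 <= 1.
    have dl1 : delta <= 1 by lra.
    have : delta * theta <= 1 by apply: mulr_ile1 => //; exact: ltW.
    lra.
  have -> : \sum_(p : I * J * 'I_N.+1) m p.1.1 * n p.1.2 * w p =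
      \sum_(p : I * J * 'I_N.+1) m p.1.1 * ((n p.1.2 * (1 - p.2%:R / N%:R)) * w p) +
      \sum_(p : I * J * 'I_N.+1) n p.1.2 * ((m p.1.1 * (p.2%:R / N%:R)) * w p).
    by rewrite -big_split/=; apply: eq_bigr => p _; ring.
  rewrite (sum_fiber (fun p : I * J * 'I_N.+1 => p.1.1) m).
  rewrite (sum_fiber (fun p : I * J * 'I_N.+1 => p.1.2) n).
  rewrite mulrDr -[in leRHS]mM -[in leRHS]nM !mulr_sumr; apply: lerD; apply: ler_sum => i _.
    rewrite mulrC ler_pM2r//; under eq_bigr do rewrite mulrA.
    by have := rowP i; rewrite ler_norml => /andP[_]; lra.
  rewrite mulrC ler_pM2r//; under eq_bigr do rewrite mulrA.
  by have := colP i; rewrite ler_norml => /andP[_]; lra.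
pose phi1 x := \sum_i u i * chi i x - 4 * eps.
pose phi2 x := \sum_j v j * psi j x - 4 * eps.
exists phi1, phi2; split.
- split=> x; apply: cvgB; try exact: cvg_cst.
    by apply: continuous_sumr => i _ y; apply: cvgM; [exact: cvg_cst|exact: cchi].
  by apply: continuous_sumr => i _ y; apply: cvgM; [exact: cvg_cst|exact: cpsi].
- split=> x.
    have := @average_le R I (chi ^~ x) u S (chi0 ^~ x) (chi1 x) (fun i _ => uS i).
    rewrite /phi1; under eq_bigr do rewrite mulrC.
    lra.
  have := @average_le R J (psi ^~ x) v S (psi0 ^~ x) (psi1 x) (fun i _ => vS i).
  rewrite /phi2; under eq_bigr do rewrite mulrC.
  lra.
- move=> x1 x2 t t01'.
  have key : \sum_i chi i x1 * (u i * (1 - t) + (\sum_j psi j x2 * v j) * t) <=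
      trunc_slice H L x1 x2 t + 4 * eps.
    apply: average_le => // i ci.
    have -> : u i * (1 - t) + (\sum_j psi j x2 * v j) * t =
        \sum_j psi j x2 * (u i * (1 - t) + v j * t).
      under [RHS]eq_bigr do rewrite mulrDr.
      rewrite big_split/= -mulr_suml psi1 mul1r mulr_suml; congr (_ + _).
      by apply: eq_bigr => j _; rewrite mulrA.
    apply: average_le => // j cj.
    have := closeP _ _ _ _ _ t01' ci cj; rewrite ler_norml => /andP[_ h].
    have := feas i j t t01'; lra.
  move: key; under eq_bigr do rewrite mulrDr mulrA.
  rewrite big_split/= -!mulr_suml chi1 mul1r /phi1 /phi2.
  under [X in _ -> (X - _) * _ + _ <= _]eq_bigr do rewrite mulrC.
  under [X in _ -> _ + (X - _) * _ <= _]eq_bigr do rewrite mulrC.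
  lra.
- apply: (le_trans primal); rewrite lee_fin.
  have I1 : fine (\int[mu1]_x (phi1 x)%:E)%E = \sum_i m i * u i - 4 * eps * M1.
    rewrite /phi1 integral_affine//= mulNr; congr (_ - _).
    by apply: eq_bigr => i _; rewrite mulrC.
  have I2 : fine (\int[mu2]_x (phi2 x)%:E)%E = \sum_j n j * v j - 4 * eps * M2.
    rewrite /phi2 integral_affine//= mulNr; congr (_ - _).
    by apply: eq_bigr => i _; rewrite mulrC.
  rewrite I1 I2.
  have -> : \sum_(p : I * J * 'I_N.+1)
      m p.1.1 * n p.1.2 * (k p.1.1 p.1.2 (p.2%:R / N%:R) + 2 * eps) * w p =
    \sum_(p : I * J * 'I_N.+1)
      m p.1.1 * n p.1.2 * (k p.1.1 p.1.2 (p.2%:R / N%:R) + eps) * w p +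
    eps * \sum_(p : I * J * 'I_N.+1) m p.1.1 * n p.1.2 * w p.
    by rewrite mulr_sumr -big_split/=; apply: eq_bigr => p _; ring.
  have h1 : eps * \sum_(p : I * J * 'I_N.+1) m p.1.1 * n p.1.2 * w p <=
      eps * (2 * (M1 + M2)) by rewrite ler_pM2l.
  have h2 : 2 * theta * (M1 + M2) * C = eps * (M1 + M2) * C by rewrite /theta; lra.
  rewrite h2; lra.
Qed.

(** * Existence of optimal potentials *)

(** By homogeneity the constraint only has to be tested on radii of sum [1]. *)
Lemma Phi_of_slices (R : realType) (X1 X2 : ptopologicalType)
    (H : cone R X1 * cone R X2 -> \bar R) (phi1 : X1 -> R) (phi2 : X2 -> R) :
  (forall y, (0 <= H y)%E) -> radially_homogeneous H ->
  Cb R X1 phi1 -> Cb R X2 phi2 ->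
  (forall x1 x2 t, 0 <= t <= 1 ->
    ((phi1 x1 * (1 - t) + phi2 x2 * t)%:E <= slice H x1 x2 t)%E) ->
  Phi_ H (phi1, phi2).
Proof.
move=> H0 Hh c1 c2 sub; split => // x1 x2 r1 r2.
have [r10 r20] : 0 <= r1%:num /\ 0 <= r2%:num by split.
have [s0|sn0] := eqVneq (r1%:num + r2%:num) 0.
  have r1E : r1%:num = 0 by lra.
  have r2E : r2%:num = 0 by lra.
  by rewrite r1E r2E !mulr0 addr0; exact: H0.
have s0 : 0 < r1%:num + r2%:num by rewrite lt_def sn0 addr_ge0.
set s := r1%:num + r2%:num in s0 sn0; pose t := r2%:num / s.
have r2E : r2%:num = s * t by rewrite /t mulrC divfK.
have r1E : r1%:num = s * (1 - t) by rewrite mulrBr mulr1 -r2E /s addrK.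
have t01 : 0 <= t <= 1.
  by rewrite /t divr_ge0 ?(ltW s0)//= ler_pdivrMr// mul1r /s lerDr.
have -> : (cone_class x1 r1, cone_class x2 r2) =
    polar ((x1, x2), (s * (1 - t), s * t)) :> (cone R X1 * cone R X2).
  rewrite -r1E -r2E; congr pair; congr cone_class; apply/val_inj => /=;
  by rewrite ger0_norm.
rewrite polar_hom//; last 2 first.
- by have := t01; lra.
- by have := t01; lra.
have -> : phi1 x1 * r1%:num + phi2 x2 * r2%:num =
    s * (phi1 x1 * (1 - t) + phi2 x2 * t) by rewrite r1E r2E; ring.
by rewrite EFinM lee_pmul2l//; exact: sub.
Qed.

(** The mass condition says that [t0 = M2 / (M1 + M2)] satisfies two strict
    linear inequalities, and [delta] is half of the slack that they leave. *)
Lemma cone_range (R : realType) (q1 q2 M1 M2 : R) :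
  0 <= q1 -> 0 <= q2 -> 0 < M1 -> 0 < M2 -> q1 < M2 / M1 -> q2 < M1 / M2 ->
  exists t0 delta, [/\ t0 * (M1 + M2) = M2, 0 < delta,
    0 <= t0 - delta, t0 + delta <= 1 &
    forall t, t0 - delta <= t <= t0 + delta -> (1 - t) * q1 < t /\ t * q2 < 1 - t].
Proof.
move=> q10 q20 M10 M20; rewrite !ltr_pdivlMr// => h1 h2.
have M12 : 0 < M1 + M2 by rewrite addr_gt0.
pose t0 := M2 / (M1 + M2).
have t0E : t0 * (M1 + M2) = M2 by rewrite /t0 divfK// gt_eqF.
have p1 : 0 < 1 + q1 by lra.
have p2 : 0 < 1 + q2 by lra.
have g1 : 0 < t0 * (1 + q1) - q1.
  rewrite -(pmulr_lgt0 _ M12).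
  have -> : (t0 * (1 + q1) - q1) * (M1 + M2) =
    (t0 * (M1 + M2)) * (1 + q1) - q1 * (M1 + M2) by ring.
  rewrite t0E; lra.
have g2 : 0 < 1 - t0 * (1 + q2).
  rewrite -(pmulr_lgt0 _ M12).
  have -> : (1 - t0 * (1 + q2)) * (M1 + M2) =
    (M1 + M2) - (t0 * (M1 + M2)) * (1 + q2) by ring.
  rewrite t0E; lra.
pose d1 := (t0 * (1 + q1) - q1) / (1 + q1).
pose d2 := (1 - t0 * (1 + q2)) / (1 + q2).
have d10 : 0 < d1 by rewrite divr_gt0.
have d20 : 0 < d2 by rewrite divr_gt0.
have d1E : d1 * (1 + q1) = t0 * (1 + q1) - q1 by rewrite /d1 divfK// gt_eqF.
have d2E : d2 * (1 + q2) = 1 - t0 * (1 + q2) by rewrite /d2 divfK// gt_eqF.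
pose delta := Num.min (d1 / 2) (d2 / 2).
have de0 : 0 < delta by rewrite lt_min !divr_gt0.
have de1 : delta <= d1 / 2 by rewrite ge_min lexx.
have de2 : delta <= d2 / 2 by rewrite ge_min lexx orbT.
have lo t : t0 - delta <= t -> q1 < t * (1 + q1).
  move=> tlo; apply: (@lt_le_trans _ _ ((t0 - delta) * (1 + q1))); last first.
    by rewrite ler_pM2r.
  have : delta * (1 + q1) <= d1 / 2 * (1 + q1) by rewrite ler_pM2r.
  have := mulr_gt0 d10 p1; lra.
have hi t : t <= t0 + delta -> t * (1 + q2) < 1.
  move=> thi; apply: (@le_lt_trans _ _ ((t0 + delta) * (1 + q2))).
    by rewrite ler_pM2r.
  have : delta * (1 + q2) <= d2 / 2 * (1 + q2) by rewrite ler_pM2r.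
  have := mulr_gt0 d20 p2; lra.
exists t0, delta; split => //.
- have := lo (t0 - delta) (lexx _) => h.
  by rewrite -(pmulr_lge0 _ p1); lra.
- have h := hi (t0 + delta) (lexx _).
  have : 0 <= t0 + delta.
    by rewrite addr_ge0 ?ltW// /t0 divr_gt0.
  nra.
- move=> t /andP[/lo h /hi h']; split; lra.
Qed.

Theorem theorem3 (R : realType) (X1 X2 : ptopologicalType)
    (cX1 : compact [set: X1]) (mX1 : metrizable R X1)
    (cX2 : compact [set: X2]) (mX2 : metrizable R X2)
    (q1 q2 : R) (q1_ge0 : 0 <= q1) (q2_ge0 : 0 <= q2)
    (H : cone R X1 * cone R X2 -> \bar R)
    (H_ge0 : forall y, (0 <= H y)%E)
    (H_cont : forall y, y <> (apex, apex) -> {for y, continuous H})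
    (H_hom : radially_homogeneous H)
    (H_conv : radially_convex H)
    (H_dom : effective_domain H `\ (apex, apex) = U_ q1 q2)
    (H_lim1 : ereal_inf (range (fun x : X1 * X2 =>
        H (cone_class x.1 `|r1|%:nng, cone_class x.2 1%:nng)))
      @[r1 --> q2^'+] --> +oo%E)
    (H_lim2 : ereal_inf (range (fun x : X1 * X2 =>
        H (cone_class x.1 1%:nng, cone_class x.2 `|r2|%:nng)))
      @[r2 --> q1^'+] --> +oo%E)
    (mu1 : {finite_measure set (borel X1) -> \bar R})
    (mu2 : {finite_measure set (borel X2) -> \bar R})
    (mu1_radon : radon X1 mu1) (mu2_radon : radon X2 mu2)
    (supp_mu1 : msupport X1 mu1 = setT) (supp_mu2 : msupport X2 mu2 = setT)
    (q1_lt : q1 < fine (mu2 setT) / fine (mu1 setT))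
    (q2_lt : q2 < fine (mu1 setT) / fine (mu2 setT)) :
  exists2 phi, Phi_ H phi &
    (\int[mu1]_x (phi.1 x)%:E + \int[mu2]_x (phi.2 x)%:E)%E
    = unbalanced_cost H mu1 mu2.
Proof.
pose M1 := fine (mu1 setT); pose M2 := fine (mu2 setT).
have M10 : 0 < M1.
  apply: fine_gt0; apply/andP; split; last by rewrite ltey_eq fin_num_measure.
  have : msupport X1 mu1 point by rewrite supp_mu1.
  by apply => //; exact: openT.
have M20 : 0 < M2.
  apply: fine_gt0; apply/andP; split; last by rewrite ltey_eq fin_num_measure.
  have : msupport X2 mu2 point by rewrite supp_mu2.
  by apply => //; exact: openT.
have [t0 [delta [t0E d0 dlo dhi range]]] :=
  cone_range q1_ge0 q2_ge0 M10 M20 q1_lt q2_lt.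
have domP x1 x2 t : 0 <= t <= 1 ->
    ((slice H x1 x2 t < +oo)%E <-> (1 - t) * q1 < t /\ t * q2 < 1 - t).
  move=> /andP[t0' t1'].
  have ya : polar ((x1, x2), (1 - t, t)) <> (apex, apex) :> cone R X1 * cone R X2.
    apply: polar_neq_apex => /=; rewrite xpair_eqE negb_and.
    by have [->|] := eqVneq t 0; rewrite ?orbT// subr0 oner_eq0.
  have UE : U_ q1 q2 (polar ((x1, x2), (1 - t, t))) =
      ((1 - t) * q1 < t /\ t * q2 < 1 - t).
    rewrite /U_ /= /rad1 /rad2 /= !cone_radiusE /= ger0_norm ?subr_ge0//.
    by rewrite ger0_norm.
  rewrite -UE -H_dom; split=> [h|[h _]//]; by split.
have cX12 : compact [set: X1 * X2] by rewrite -setXTT; exact: compact_setX.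
have csl : continuous (fun p : (X1 * X2) * R => slice H p.1.1 p.1.2 p.2).
  exact: slice_continuous.
have cslt t : continuous (fun x : X1 * X2 => slice H x.1 x.2 t).
  move=> x; have c1 : (fun x : X1 * X2 => (x, t)) @ x --> (x, t).
    by apply: (@continuous_pair _ _ _ id (fun=> t) x); [exact: cvg_id|exact: cvg_cst].
  exact: (cvg_comp _ _ c1 (csl (x, t))).
have [Clo CloP] : exists C : R, forall x, (slice H x.1 x.2 (t0 - delta) <= C%:E)%E.
  apply: compact_ereal_bounded => // -[x1 x2] /=.
  by apply/domP; [lra|apply: range; lra].
have [Chi ChiP] : exists C : R, forall x, (slice H x.1 x.2 (t0 + delta) <= C%:E)%E.
  apply: compact_ereal_bounded => // -[x1 x2] /=.
  by apply/domP; [lra|apply: range; lra].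
pose C := Num.max Clo Chi.
have ClP x1 x2 : (slice H x1 x2 (t0 - delta) <= C%:E)%E.
  by apply: le_trans (CloP (x1, x2)) _; rewrite lee_fin le_max lexx.
have ChP x1 x2 : (slice H x1 x2 (t0 + delta) <= C%:E)%E.
  by apply: le_trans (ChiP (x1, x2)) _; rewrite lee_fin le_max lexx orbT.
have C0 : 0 <= C by rewrite -lee_fin; apply: le_trans (ClP point point); exact: H_ge0.
pose S := (C + 2) * (1 + delta^-1).
have S0 : 0 <= S.
  by rewrite /S mulr_ge0 ?addr_ge0 ?invr_ge0// ltW.
(* The margin [3] absorbs the displacements of size at most [2 * eps <= 2]. *)
pose L := S + 3; have L0 : 0 <= L by rewrite /L addr_ge0.
have inf0 (x : X1 * X2) : slice H x.1 x.2 0 = +oo%E.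
  apply/eqP; rewrite -leye_eq leNgt; apply/negP => /domP[]; first by lra.
  by rewrite subr0 mul1r => h _; lra.
have inf1 (x : X1 * X2) : slice H x.1 x.2 1 = +oo%E.
  apply/eqP; rewrite -leye_eq leNgt; apply/negP => /domP[]; first by lra.
  by rewrite subrr mul0r mul1r => _ h; lra.
have [sg0 sg00 sg0P] := compact_blowup L cX12 csl inf0.
have [sg1 sg10 sg1P] := compact_blowup L cX12 csl inf1.
pose sigma := Num.min sg0 sg1.
have sg_gt0 : 0 < sigma by rewrite lt_min sg00.
have cap_lo x1 x2 t : 0 <= t <= sigma -> S <= trunc_slice H L x1 x2 t.
  rewrite /sigma le_min => /andP[t0' /andP[h _]]; rewrite trunc_slice_cap//; last first.
    by apply: (sg0P (x1, x2)); rewrite sub0r normrN ger0_norm.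
  by rewrite /L; lra.
have cap_hi x1 x2 t : 1 - sigma <= t <= 1 -> S <= trunc_slice H L x1 x2 t.
  move=> /andP[h t1]; rewrite trunc_slice_cap//; last first.
    apply: (sg1P (x1, x2)); rewrite ger0_norm ?subr_ge0//.
    have : sigma <= sg1 by rewrite ge_min lexx orbT.
    lra.
  by rewrite /L; lra.
pose K := (M1 + M2) * (6 + C).
have K0 : 0 < K by apply: mulr_gt0; [exact: addr_gt0|lra].
have /choice[phi /choice[psi]] : forall n : nat, exists (phi : (X1 -> R) * (X2 -> R))
    (psi : (X1 -> R) * (X2 -> R)),
    [/\ continuous phi.1 /\ continuous phi.2,
      (forall x, phi.1 x <= psi.1 x) /\ (forall x, phi.2 x <= psi.2 x),
      dual_feasible (trunc_slice H L) psi.1 psi.2,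
      ((forall x, `|psi.1 x| <= S + S / sigma) /\
       (forall x, `|psi.2 x| <= S + S / sigma)) /\
      ((forall x y e, 0 <= e -> close_cost (trunc_slice H L) e x y ->
        `|psi.1 x - psi.1 y| <= e / sigma) /\
       (forall x y e, 0 <= e ->
        close_cost (fun x2 x1 t => trunc_slice H L x1 x2 (1 - t)) e x y ->
        `|psi.2 x - psi.2 y| <= e / sigma)) &
      (unbalanced_cost H mu1 mu2 <= (fine (\int[mu1]_x (phi.1 x)%:E) +
        fine (\int[mu2]_x (phi.2 x)%:E) + K * n.+1%:R^-1)%:E)%E].
  move=> n.
  have n0 : 0 < n.+1%:R^-1 :> R by rewrite invr_gt0.
  have n1 : n.+1%:R^-1 <= 1 :> R by rewrite invf_le1// ler1n.
  have [p1 [p2 [[cp1 cp2] [p1S p2S] sub bound]]] :=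
    near_optimal cX1 mX1 cX2 mX2 H_ge0 H_cont H_hom H_conv mu1_radon mu2_radon
      supp_mu1 supp_mu2 M10 M20 t0E d0 dlo dhi ClP ChP L0 (lexx _) n0 n1.
  have [f1 [f2 [sub' le1 le2 bnd modul]]] :=
    potentials_improve S0 sg_gt0 (fun x1 x2 t _ => trunc_slice_ge0 H_ge0 L0 x1 x2 t)
      cap_hi cap_lo p1S p2S sub.
  by exists (p1, p2), (f1, f2).
move=> phipsiP.
have [F [FU Foo]] := @ultraFilterLemma nat \oo _.
have lim1 := @ultra_uniform_limit R X1 F (S + S / sigma) (fun n => (psi n).1) FU cX1.
have lim2 := @ultra_uniform_limit R X2 F (S + S / sigma) (fun n => (psi n).2) FU cX2.
have [|x e e0|g1 cg1 g1P] := lim1.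
- by move=> n x; have [_ _ _ [[h _] _] _] := phipsiP n.
- have es0 : 0 < e * sigma by rewrite mulr_gt0.
  apply: filterS (near_close1 cX2 H_ge0 H_cont L0 x es0) => y xy n.
  have [_ _ _ [_ [h _]] _] := phipsiP n.
  by have := h x y _ (ltW es0) xy; rewrite mulfK// gt_eqF.
have [|x e e0|g2 cg2 g2P] := lim2.
- by move=> n x; have [_ _ _ [[_ h] _] _] := phipsiP n.
- have es0 : 0 < e * sigma by rewrite mulr_gt0.
  apply: filterS (near_close2 cX1 H_ge0 H_cont L0 x es0) => y xy n.
  have [_ _ _ [_ [_ h]] _] := phipsiP n.
  by have := h x y _ (ltW es0) xy; rewrite mulfK// gt_eqF.
have approx e : 0 < e -> exists n, [/\ n.+1%:R^-1 < e,
    forall x, `|(psi n).1 x - g1 x| <= e & forall x, `|(psi n).2 x - g2 x| <= e].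
  move=> e0.
  have h0 : \forall n \near F, n.+1%:R^-1 < e.
    by apply: Foo; exact: (near_infty_natSinv_lt (PosNum e0)).
  have FP : ProperFilter F by exact: ultra_proper.
  have FF := @filter_filter _ F FP.
  have := @filterI _ F FF _ _ h0 (@filterI _ F FF _ _ (g1P e e0) (g2P e e0)).
  by move=> /(@filter_ex _ F FP)[n [? [? ?]]]; exists n.
have Cg1 : Cb R X1 g1 by exact: compact_Cb.
have Cg2 : Cb R X2 g2 by exact: compact_Cb.
have subG : dual_feasible (trunc_slice H L) g1 g2.
  apply: dual_feasible_limit => e /approx[n [_ h1 h2]].
  have [_ _ sub _ _] := phipsiP n.
  by exists (psi n).1, (psi n).2.
have PhiG : Phi_ H (g1, g2).
  apply: Phi_of_slices => // x1 x2 t t01.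
  apply: le_trans (trunc_slice_le_slice H_ge0 L0 x1 x2 t); rewrite lee_fin.
  exact: subG.
exists (g1, g2) => //.
have mH := cost_measurable H_cont.
apply/eqP; rewrite eq_le; apply/andP; split.
  apply: le_ereal_inf_tmp => _ [alpha alphaP <-].
  by apply: (weak_duality alphaP _ mH PhiG).
have i1 := Cb_integrable mu1 Cg1; have i2 := Cb_integrable mu2 Cg2.
rewrite /= -(fineK (integrable_fin_num measurableT i1)).
rewrite -(fineK (integrable_fin_num measurableT i2)) -EFinD.
apply/lee_addgt0Pr => e e0.
(* [K * e'] pays for the near-optimality, the rest for replacing [psi n] by
   its limit. *)
pose e' := e / (K + M1 + M2).
have KM0 : 0 < K + M1 + M2 by rewrite !addr_gt0.
have e'0 : 0 < e' by rewrite divr_gt0.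
have [n [ne h1 h2]] := approx e' e'0.
have [[cp1 cp2] [le1 le2] _ _ bound] := phipsiP n.
apply: (le_trans bound); rewrite -EFinD lee_fin.
have j1 : fine (\int[mu1]_x ((phi n).1 x)%:E) <=
    fine (\int[mu1]_x (g1 x)%:E) + e' * M1.
  apply: integral_le_add => //; first exact: compact_Cb.
  move=> x; apply: le_trans (le1 x) _; rewrite -lerBlDl.
  exact: le_trans (ler_norm _) (h1 x).
have j2 : fine (\int[mu2]_x ((phi n).2 x)%:E) <=
    fine (\int[mu2]_x (g2 x)%:E) + e' * M2.
  apply: integral_le_add => //; first exact: compact_Cb.
  move=> x; apply: le_trans (le2 x) _; rewrite -lerBlDl.
  exact: le_trans (ler_norm _) (h2 x).
have j3 : K * n.+1%:R^-1 <= K * e' by rewrite ler_pM2l// ltW.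
have eE : e' * (K + M1 + M2) = e by rewrite /e' divfK// gt_eqF.
apply: (le_trans (lerD (lerD j1 j2) j3)).
by rewrite -eE le_eqVlt; apply/orP; left; apply/eqP; rewrite /=; ring.
Qed.
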